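(* Let $\delta<1$ be a constant and let $k=k(n)$ be any number-of-players function with $k(n)\le \delta\log_2 n$. Then $\mathsf{NP}^{cc}_k \not\subseteq \mathsf{BPP}^{cc}_k$; that is, there is a family of functions $F=(F_n)_{n\in\mathbb{N}}$, $F_n:(\{0,1\}^n)^{k}\to\{0,1\}$, such that $N_k(F_n)=(\log n)^{O(1)}$ but $R_k(F_n)$ is not $(\log n)^{O(1)}$. Consequently $\mathsf{NP}^{cc}_k \neq \mathsf{RP}^{cc}_k$.
   Context: Number-on-forehead (NOF) model: $k$ players compute $F:X_1\times\cdots\times X_k\to\{0,1\}$ with $X_i=\{0,1\}^n$; player $i$ sees every input piece except $x_i$. Players write bits on a shared blackboard according to a protocol (which determines, from the blackboard contents, whether communication has ended, the output if so, and otherwise who speaks next and what that player writes as a function of the blackboard and the inputs it sees). The cost of a protocol is the maximum number of bits written. A randomized protocol of cost $c$ is a probability distribution over deterministic protocols of cost $c$ (public randomness). A nondeterministic protocol starts with a guess string on the blackboard, and $F(x)=1$ iff some guess makes the protocol output $1$. $D_k(F)$ is the deterministic complexity; $R_k(F)$ is the minimum cost of a randomized protocol erring with probability at most $1/3$ on every input; $R^1_k(F)$ is the minimum cost of a randomized protocol that is always correct on $0$-inputs and errs with probability at most $1/3$ on every $1$-input; $N_k(F)$ is the minimum cost of a nondeterministic protocol (including guess length). For families $F=(F_n)$, $\mathsf{P}^{cc}_k,\mathsf{RP}^{cc}_k,\mathsf{BPP}^{cc}_k,\mathsf{NP}^{cc}_k$ are the classes of families for which $D_k(F_n)$, $R^1_k(F_n)$,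 $R_k(F_n)$, $N_k(F_n)$, respectively, are $(\log n)^{O(1)}$. *)

(* Defs.v *)
From mathcomp Require Import all_boot all_order all_algebra.
From mathcomp Require Import all_classical all_reals all_analysis.

Set Implicit Arguments.
Unset Strict Implicit.
Unset Printing Implicit Defensive.

Import Order.TTheory GRing.Theory Num.Theory.

Local Open Scope classical_set_scope.
Local Open Scope ring_scope.

Definition input (k n : nat) := {ffun 'I_k -> n.-tuple bool}.

Definition view (k n : nat) (i : 'I_k) :=
  {ffun {j : 'I_k | j != i} -> n.-tuple bool}.

Definition see (k n : nat) (x : input k n) (i : 'I_k) : view n i :=
  [ffun j => x (val j)].

(** [action b] is [inl v] when the communication has ended with output [v] on
    blackboard contents [b], and [inr i] when player [i] writes the next bit. *)
Record protocol (k n : nat) := Protocol {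
  action : seq bool -> bool + 'I_k;
  message : seq bool -> forall i : 'I_k, view n i -> bool }.

Section Protocols.
Variables k n : nat.
Implicit Types (p : protocol k n) (x : input k n) (b : seq bool).

Definition step p x b : seq bool :=
  match action p b with
  | inl _ => b
  | inr i => rcons b (message p b (see x i))
  end.

Definition ended p b : bool := if action p b is inl _ then true else false.

(** The communication started on blackboard [b] writes at most [t] bits. *)
Definition writes_at_most p x b (t : nat) : Prop :=
  ended p (iter t (step p x) b).

Definition outputs p x b (v : bool) : Prop :=
  exists t, action p (iter t (step p x) b) = inl v.

Definition cost_at_most p (c : nat) : Prop :=
  forall x, writes_at_most p x [::] c.

(** [l] is the length of the guess, which counts towards the cost. *)
Definition nondet_computes p (F : input k n -> bool) (l c : nat) : Prop :=
  (exists2 t, (l + t <= c)%N &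
     forall (g : l.-tuple bool) x, writes_at_most p x g t) /\
  (forall x, F x = true <-> exists g : l.-tuple bool, outputs p x g true).

End Protocols.

(** A distribution over protocols of cost at most [c], presented as the law of a
    random protocol on an arbitrary probability space; [det_measurable] says
    that the events used to define the error probability are measurable. *)
Record randomized_protocol (R : realType) (k n c : nat) := RandomizedProtocol {
  coin_display : measure_display;
  coins : measurableType coin_display;
  law : probability coins R;
  det : coins -> protocol k n;
  det_cost : forall w, cost_at_most (det w) c;
  det_measurable : forall x v, measurable [set w | outputs (det w) x [::] v] }.

Section Complexity.
Variables (R : realType) (k n : nat).

Definition error (c : nat) (P : randomized_protocol R k n c)
    (F : input k n -> bool) (x : input k n) : \bar R :=
  law P [set w : coins P | ~ outputs (det w) x [::] (F x)].

(** Equal to [+oo] when no cost is achievable, as for a nonconstant [F] when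
    [k = 1]; otherwise the infimum, being over naturals, is attained. *)
Definition min_cost (achievable : nat -> Prop) : \bar R :=
  ereal_inf [set c%:R%:E | c in achievable].

Definition N_complexity (F : input k n -> bool) : \bar R :=
  min_cost (fun c => exists (p : protocol k n) (l : nat),
    nondet_computes p F l c).

Definition R_complexity (F : input k n -> bool) : \bar R :=
  min_cost (fun c => exists P : randomized_protocol R k n c,
    forall x, (error P F x <= (3%:R^-1)%:E)%E).

Definition R1_complexity (F : input k n -> bool) : \bar R :=
  min_cost (fun c => exists P : randomized_protocol R k n c,
    forall x, (F x = false -> error P F x = 0%E) /\
              (F x = true -> (error P F x <= (3%:R^-1)%:E)%E)).

End Complexity.

Definition log2 (R : realType) (x : R) : R := ln x / ln 2.

Definition polylog (R : realType) (f : nat -> \bar R) : Prop :=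
  exists a : nat, \forall n \near \oo, (f n <= (log2 (n%:R : R) ^+ a)%:E)%E.

Definition function_family (k : nat -> nat) := forall n, input (k n) n -> bool.

Definition NPcc (R : realType) (k : nat -> nat) : set (function_family k) :=
  [set F | polylog (fun n => N_complexity R (F n))].

Definition BPPcc (R : realType) (k : nat -> nat) : set (function_family k) :=
  [set F | polylog (fun n => R_complexity R (F n))].

Definition RPcc (R : realType) (k : nat -> nat) : set (function_family k) :=
  [set F | polylog (fun n => R1_complexity R (F n))].

Arguments NPcc R k : clear implicits.
Arguments BPPcc R k : clear implicits.
Arguments RPcc R k : clear implicits.

(* Main.v *)
Require Import Defs.
From mathcomp Require Import all_boot all_order all_algebra.
From mathcomp Require Import all_classical all_reals all_analysis.
From mathcomp Require Import measurable_realfun.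
From mathcomp Require Import ring lra zify.

Set Implicit Arguments.
Unset Strict Implicit.
Unset Printing Implicit Defensive.

Import Order.TTheory GRing.Theory Num.Theory.

Local Open Scope classical_set_scope.
Local Open Scope ring_scope.

(** The separating function lets players [1, ..., k - 1] jointly select, by a
    random map [phi], one position in each of [m] blocks of the string of player
    [0], and takes the disjunction of the selected bits. A nondeterministic
    protocol guesses a selected position holding a [1].

    For the lower bound, the disjunction on [m] bits has a signed weight, a
    combination of product Bernoulli measures with biases [0 < 1/M < 16 i^2/M]
    given by a divided difference: it has norm at most [5/2], correlates
    at least [19/10] with the disjunction, and vanishes on functions of [D] bits,
    [D] being about the square root of [m]. Lifting it through [phi] and applying
    Cauchy-Schwarz once per player in [1, ..., k - 1] bounds its correlation with
    a cylinder intersection by an average, over [2^(k-1)] points of a cube, of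
    a term that is [0] unless each point shares more than [D] of its
    selected positions with the others. A random [phi] makes that so unlikely
    that the correlation is at most [5 / 2^D], so a randomized protocol has cost
    at least [D - 5]. All this needs [n] at least of the order of [2^k D^4], which
    with [k <= delta log n] allows [D] to be a power of [n]. *)

(** * Averages and cylinder intersections *)

Section Mean.
Variable R : realType.
Implicit Types T U : finType.

Definition mean T (f : T -> R) : R := (\sum_x f x) / #|T|%:R.

Lemma eq_mean T (f g : T -> R) : f =1 g -> mean f = mean g.
Proof. by move=> fg; rewrite /mean; congr (_ / _); apply: eq_bigr => x _. Qed.

Lemma le_mean T (f g : T -> R) : (forall x, f x <= g x) -> mean f <= mean g.
Proof.
by move=> fg; rewrite /mean ler_wpM2r ?invr_ge0 ?ler0n//; apply: ler_sum.
Qed.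

Lemma mean_ge0 T (f : T -> R) : (forall x, 0 <= f x) -> 0 <= mean f.
Proof. by move=> f0; rewrite /mean mulr_ge0 ?invr_ge0 ?ler0n// sumr_ge0. Qed.

Lemma mean_cst T (c : R) : (0 < #|T|)%N -> mean (fun _ : T => c) = c.
Proof.
move=> T0; have -> : mean (fun _ : T => c) = c * #|T|%:R / #|T|%:R.
  by rewrite /mean sumr_const mulr_natr.
by rewrite mulfK// pnatr_eq0 -lt0n.
Qed.

Lemma meanD T (f g : T -> R) : mean (fun x => f x + g x) = mean f + mean g.
Proof. by rewrite /mean big_split mulrDl. Qed.

Lemma meanZl T c (f : T -> R) : mean (fun x => c * f x) = c * mean f.
Proof. by rewrite /mean -mulr_sumr mulrA. Qed.

Lemma meanZr T c (f : T -> R) : mean (fun x => f x * c) = mean f * c.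
Proof. by rewrite /mean -mulr_suml mulrAC. Qed.

Lemma meanB T (f g : T -> R) : mean (fun x => f x - g x) = mean f - mean g.
Proof. by rewrite /mean sumrB mulrBl. Qed.

Lemma mean_sum T I (r : seq I) (P : pred I) (f : I -> T -> R) :
  mean (fun x => \sum_(i <- r | P i) f i x) = \sum_(i <- r | P i) mean (f i).
Proof. by rewrite /mean exchange_big/= mulr_suml. Qed.

Lemma exchange_mean T U (f : T -> U -> R) :
  mean (fun x => mean (f x)) = mean (fun y => mean (f^~ y)).
Proof.
rewrite /mean -!mulr_suml exchange_big/= -!mulrA; congr (_ * _).
exact: mulrC.
Qed.

Lemma mean_pair T U (f : T * U -> R) :
  mean f = mean (fun x => mean (fun y => f (x, y))).
Proof.
rewrite /mean -mulr_suml pair_big/= card_prod natrM invfM mulrA mulrAC.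
by congr (_ / _ / _); apply: eq_bigr => -[].
Qed.

Lemma ler_norm_mean T (f : T -> R) : `|mean f| <= mean (fun x => `|f x|).
Proof.
rewrite /mean normrM normfV (ger0_norm (ler0n _ _)).
by rewrite ler_wpM2r ?invr_ge0 ?ler0n// ler_norm_sum.
Qed.

Lemma mean_le_exists T (f : T -> R) (a : R) :
  (0 < #|T|)%N -> mean f <= a -> exists x, f x <= a.
Proof.
move=> T0 fa; apply: contrapT => nex.
have fgt x : a < f x by rewrite ltNge; apply/negP => fx; apply: nex; exists x.
move: fa; rewrite leNgt => /negP; apply.
rewrite -(mean_cst a T0) /mean ltr_pM2r ?invr_gt0 ?ltr0n//.
have /card_gt0P[x0 _] := T0.
rewrite (bigD1 x0)//= [ltRHS](bigD1 x0)//= ltr_leD//.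
by apply: ler_sum => x _; exact: ltW.
Qed.

Lemma mean_sqr T (f : T -> R) : mean f ^+ 2 <= mean (fun x => f x ^+ 2).
Proof.
have [T0|T0] := posnP #|T|.
  by rewrite /mean T0 invr0 !mulr0 expr0n.
set a := mean f.
have : 0 <= mean (fun x => (f x - a) ^+ 2) by apply: mean_ge0 => x; rewrite sqr_ge0.
have -> : mean (fun x => (f x - a) ^+ 2) =
    mean (fun x => f x ^+ 2) - (a *+ 2 * mean f - a ^+ 2).
  rewrite -[in LHS](@eq_mean _ (fun x => f x ^+ 2 - (a *+ 2 * f x - a ^+ 2))).
    by rewrite meanB meanB meanZl mean_cst.
  by move=> x; ring.
by rewrite -/a subr_ge0; apply: le_trans; rewrite le_eqVlt; apply/orP; left; apply/eqP; ring.
Qed.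

Lemma mean_exp2n T (f : T -> R) k :
  (forall x, 0 <= f x) -> mean f ^+ (2 ^ k) <= mean (fun x => f x ^+ (2 ^ k)).
Proof.
move=> f0; elim: k => [|k IH].
  by rewrite expn0 expr1 (eq_mean (fun x => expr1 _)).
rewrite expnSr exprM (eq_mean (fun x => exprM _ _ _)).
apply: le_trans (mean_sqr _); rewrite lerXn2r ?nnegrE ?exprn_ge0//.
  exact: mean_ge0.
by apply: mean_ge0 => x; exact: exprn_ge0.
Qed.

Lemma mean_tupleS T n (f : n.+1.-tuple T -> R) :
  mean f = mean (fun a => mean (fun v => f (cons_tuple a v))).
Proof.
rewrite -(mean_pair (fun p : T * n.-tuple T => f (cons_tuple p.1 p.2))) /mean.
congr (_ / _).
  rewrite (reindex (fun p : T * n.-tuple T => cons_tuple p.1 p.2))//.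
  exists (fun v : n.+1.-tuple T => (thead v, behead_tuple v)) => [[a v] _|v _] /=.
    by congr (_, _); apply: val_inj.
  by rewrite [RHS]tuple_eta; apply: val_inj.
by rewrite card_prod !card_tuple expnS.
Qed.

End Mean.

Section Cube.
Variables (R : realType) (X Y : finType).

(** A product of [k.+1] factors bounded by 1, each ignoring one of the arguments. The factor [g]
    ignoring the first coordinate of the tuple is peeled off first, and the final constant [c],
    which may depend on the whole tuple, is the factor ignoring [x]. This order matches the
    induction that removes one factor per application of Cauchy-Schwarz. *)
Fixpoint cyl k : (X -> k.-tuple Y -> R) -> Prop :=
  if k is k'.+1 then fun chi =>
    exists2 g : X -> k'.-tuple Y -> R, (forall x v, `|g x v| <= 1) &
    exists2 chi' : Y -> X -> k'.-tuple Y -> R, (forall a, cyl (chi' a)) &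
      forall x a v, chi x (cons_tuple a v) = g x v * chi' a x v
  else fun chi => exists2 c : R, `|c| <= 1 & forall x v, chi x v = c.

Lemma cylM k (chi1 chi2 : X -> k.-tuple Y -> R) :
  cyl chi1 -> cyl chi2 -> cyl (fun x v => chi1 x v * chi2 x v).
Proof.
elim: k chi1 chi2 => [|k IH] chi1 chi2 /=.
  move=> [c1 c11 e1] [c2 c21 e2]; exists (c1 * c2) => [|x v].
    by rewrite normrM mulr_ile1.
  by rewrite e1 e2.
move=> [g1 g11 [h1 h1c e1]] [g2 g21 [h2 h2c e2]].
exists (fun x v => g1 x v * g2 x v) => [x v|].
  by rewrite normrM mulr_ile1.
exists (fun a x v => h1 a x v * h2 a x v) => [a|x a v]; first exact: IH.
by rewrite e1 e2 mulrACA.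
Qed.

Lemma cyl1 k : cyl (fun _ (_ : k.-tuple Y) => 1).
Proof.
elim: k => [|k IH] /=; first by exists 1 => //; rewrite normr1.
exists (fun _ _ => 1) => [*|]; first by rewrite normr1.
by exists (fun _ _ _ => 1) => [//|*]; rewrite mul1r.
Qed.

Lemma cyl_indep0 k (f : X -> k.-tuple Y -> R) :
  (forall x v, `|f x v| <= 1) -> (forall x x' v, f x v = f x' v) -> cyl f.
Proof.
elim: k f => [|k IH] f f1 fE /=.
  have [x0 _|X0] := pickP (@predT X).
    by exists (f x0 [tuple]) => // x v; rewrite (fE x x0) tuple0.
  by exists 0 => [|x]; [rewrite normr0|have := X0 x].
exists (fun _ _ => 1) => [*|]; first by rewrite normr1.
exists (fun a x v => f x (cons_tuple a v)) => [a|*]; last by rewrite mul1r.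
by apply: IH => // x x' v; exact: fE.
Qed.

(** The function fills the slot of the factor that ignores coordinate [j], and the factors peeled
    off before that slot and after it are 1. *)
Lemma cyl_indepS k (j : 'I_k) (f : X -> k.-tuple Y -> R) :
  (forall x v, `|f x v| <= 1) ->
  (forall x v v', (forall l, l != j -> tnth v l = tnth v' l) ->
     f x v = f x v') ->
  cyl f.
Proof.
elim: k j f => [|k IH] j f f1 fE; first by case: (j).
have [y0 _|Y0] := pickP (@predT Y); last first.
  exists (fun _ _ => 1) => [*|]; first by rewrite normr1.
  by exists (fun _ _ _ => 1) => [a|x a]; have := Y0 a.
case: (unliftP ord0 j) => [j'|] jE /=.
  exists (fun _ _ => 1) => [*|]; first by rewrite normr1.
  exists (fun a x v => f x (cons_tuple a v)) => [a|*]; last by rewrite mul1r.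
  apply: (IH j') => // x v v' vv'; apply: fE => l.
  case: (unliftP ord0 l) => [l' ->|-> //]; rewrite jE (inj_eq lift_inj) => /vv'.
  by rewrite !tnthS.
(* Here [j] is the first coordinate; since [f] ignores it, it can be frozen at an arbitrary [y0]. *)
exists (fun x v => f x (cons_tuple y0 v)) => //.
exists (fun _ _ _ => 1) => [_|x a v]; first exact: cyl1.
rewrite mulr1; apply: fE => l; rewrite jE.
case: (unliftP ord0 l) => [l' -> _|->]; by rewrite ?eqxx// !tnthS.
Qed.

(** The corners of the box spanned by [k] pairs. They form a list, so that corners are repeated when
    a pair has equal components. *)
Fixpoint cube k : k.-tuple (Y * Y) -> seq (k.-tuple Y) :=
  if k is k'.+1 then fun p =>
    map (fun v => cons_tuple (thead p).1 v) (cube (behead_tuple p)) ++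
    map (fun v => cons_tuple (thead p).2 v) (cube (behead_tuple p))
  else fun _ => [:: [tuple]].

Lemma cube_cons k (q : Y * Y) (p : k.-tuple (Y * Y)) :
  cube (cons_tuple q p) = map (cons_tuple q.1) (cube p) ++
                          map (cons_tuple q.2) (cube p).
Proof.
rewrite /= !theadE.
by have -> : behead_tuple (cons_tuple q p) = p by apply: val_inj.
Qed.

(** The quantity of Babai, Nisan and Szegedy that controls discrepancy: every coordinate of the
    tuple is doubled, while [x] is not. *)
Definition cubenorm k (Psi : X -> k.-tuple Y -> R) : R :=
  mean (fun p => `|mean (fun x => \prod_(v <- cube p) Psi x v)|).

Lemma cubenormS k (Psi : X -> k.+1.-tuple Y -> R) :
  cubenorm Psi = mean (fun q : Y * Y =>
    cubenorm (fun x v => Psi x (cons_tuple q.1 v) * Psi x (cons_tuple q.2 v))).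
Proof.
rewrite /cubenorm mean_tupleS; apply: eq_mean => q; apply: eq_mean => p.
congr `|_|; apply: eq_mean => x.
by rewrite cube_cons big_cat !big_map big_split.
Qed.

(** One Cauchy-Schwarz step removes the factor [g] and doubles the first coordinate into a pair [q].
    For fixed [q], the product of the two remaining copies of [chi] is again a cylinder
    intersection, so induction applies. *)
Lemma cylinder_correlation k (Psi chi : X -> k.-tuple Y -> R) :
  cyl chi ->
  `|mean (fun x => mean (fun v => Psi x v * chi x v))| ^+ (2 ^ k) <= cubenorm Psi.
Proof.
elim: k Psi chi => [|k IH] Psi chi.
  move=> [c c1 chiE]; rewrite expn0 expr1 /cubenorm.
  have mean0 (T : finType) (f : 0.-tuple T -> R) : mean f = f [tuple].
    rewrite -(mean_cst (T := 0.-tuple T) (f [tuple])) ?card_tuple//.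
    by apply: eq_mean => v; rewrite tuple0.
  rewrite mean0; rewrite (eq_mean (g := fun x => Psi x [tuple] * c)) => [|x].
    rewrite meanZr normrM (@eq_mean _ _ _ (fun x => Psi x [tuple])) => [|x].
      by rewrite ler_piMr.
    by rewrite /= big_seq1.
  by rewrite mean0 chiE.
move=> [g g1 [h hc chiE]].
pose J (q : Y * Y) := mean (fun x => mean (fun v =>
  (Psi x (cons_tuple q.1 v) * Psi x (cons_tuple q.2 v)) *
  (h q.1 x v * h q.2 x v))).
rewrite cubenormS expnS exprM.
apply: (@le_trans _ _ (mean (fun q => `|J q|) ^+ (2 ^ k))); last first.
  apply: le_trans (mean_exp2n _ _) _ => //.
  by apply: le_mean => q; apply: IH; apply: cylM; exact: hc.
rewrite lerXn2r ?nnegrE ?sqr_ge0 ?mean_ge0//.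
rewrite real_normK ?num_real//.
apply: (@le_trans _ _ (mean J)); last by apply: le_mean => q; exact: ler_norm.
(* [g] does not see the first coordinate, so it leaves the inner mean; after squaring it disappears
   because [g x v ^+ 2 <= 1]. Expanding [I x v ^+ 2] over two independent copies of [a] yields
   [J]. *)
pose I x v := mean (fun a => Psi x (cons_tuple a v) * h a x v).
have -> : mean (fun x => mean (fun v => Psi x v * chi x v)) =
    mean (fun x => mean (fun v => g x v * I x v)).
  apply: eq_mean => x; rewrite mean_tupleS exchange_mean; apply: eq_mean => v.
  by rewrite -meanZl; apply: eq_mean => a; rewrite chiE mulrCA.
apply: le_trans (mean_sqr _) _.
apply: (@le_trans _ _ (mean (fun x => mean (fun v => I x v ^+ 2)))).
  apply: le_mean => x; apply: le_trans (mean_sqr _) _; apply: le_mean => v.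
  rewrite exprMn ler_piMl ?sqr_ge0// -(real_normK (num_real (g x v))).
  by rewrite exprn_ile1.
rewrite le_eqVlt; apply/orP; left; apply/eqP.
rewrite /J [RHS]exchange_mean; apply: eq_mean => x.
rewrite [RHS]exchange_mean; apply: eq_mean => v.
rewrite mean_pair expr2 /I -meanZr; apply: eq_mean => a.
by rewrite -meanZl; apply: eq_mean => b; rewrite /=; ring.
Qed.

Lemma size_cube k (p : k.-tuple (Y * Y)) : size (cube p) = (2 ^ k)%N.
Proof.
elim: k p => [|k IH] p //=.
by rewrite size_cat !size_map IH addnn expnS mul2n.
Qed.

Definition offdiagonal k (p : k.-tuple (Y * Y)) :=
  all (fun q : Y * Y => q.1 != q.2) p.

Lemma cube_uniq k (p : k.-tuple (Y * Y)) : offdiagonal p -> uniq (cube p).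
Proof.
elim: k p => [|k IH] p //=.
rewrite [p in offdiagonal p]tuple_eta /offdiagonal /= => /andP[pne hp].
have puniq : uniq (cube (behead_tuple p)) := IH (behead_tuple p) hp.
have cons_inj a : injective (fun v : k.-tuple Y => cons_tuple a v).
  by move=> u v /(congr1 val)[uv]; apply: val_inj.
rewrite cat_uniq !map_inj_uniq// puniq /= andbT.
apply/hasPn => _ /mapP[v _ ->]; apply/negP => /mapP[u _ /(congr1 val)[/eqP]].
by rewrite eq_sym (negbTE pne).
Qed.

(** Union bound over the [k] pairs, each of which has equal components with probability
    [1 / #|Y|]. *)
Lemma mean_diagonal k : (0 < #|Y|)%N ->
  mean (fun p : k.-tuple (Y * Y) => (~~ offdiagonal p)%:R) <= k%:R / #|Y|%:R :> R.
Proof.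
move=> Y0; have Y0' : #|Y|%:R != 0 :> R by rewrite pnatr_eq0 -lt0n.
elim: k => [|k IH].
  rewrite mul0r /mean big1 ?mul0r// => p _.
  by rewrite tuple0.
rewrite mean_tupleS.
pose f (q : Y * Y) (p : k.-tuple (Y * Y)) : R :=
  (q.1 == q.2)%:R + (~~ offdiagonal p)%:R.
apply: (@le_trans _ _ (mean (fun q => mean (f q)))).
  apply: le_mean => q; apply: le_mean => p; rewrite /f /offdiagonal /=.
  by rewrite negb_and negbK -natrD ler_nat; case: (_ == _); case: (all _ _).
rewrite (eq_mean (fun q => meanD _ _)) meanD.
rewrite mean_cst ?card_prod ?muln_gt0 ?Y0//.
rewrite (eq_mean (fun q => mean_cst _ _)); last first.
  by rewrite card_tuple expn_gt0 card_prod muln_gt0 Y0.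
rewrite -natr1 mulrDl addrC lerD// mean_pair.
rewrite (eq_mean (g := fun=> #|Y|%:R^-1)) ?mean_cst ?mul1r// => a.
rewrite /mean (bigD1 a)//= eqxx big1 ?addr0 ?mul1r// => b.
by rewrite eq_sym => /negbTE ->.
Qed.

End Cube.

(** * Collisions of a random selection *)

Section Resampling.
Variables (R : realType) (T U : finType).
Implicit Types (f : {ffun T -> U}) (G H : {ffun T -> U} -> R).

Definition upd f a c : {ffun T -> U} := [ffun z => if z == a then c else f z].

Lemma updE f a c z : upd f a c z = if z == a then c else f z.
Proof. by rewrite ffunE. Qed.

(** Exchanging [f a] with a fresh value [c] is an involution on pairs [(f, c)], hence preserves the
    uniform measure. *)
Lemma mean_resample a H : (0 < #|U|)%N ->
  mean H = mean (fun f => mean (fun c => H (upd f a c))).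
Proof.
move=> U0; rewrite -(mean_pair (fun q => H (upd q.1 a q.2))).
pose sigma (q : {ffun T -> U} * U) := (upd q.1 a q.2, q.1 a).
have sigmaK : involutive sigma.
  case=> f c; rewrite /sigma /= updE eqxx; congr (_, _).
  by apply/ffunP => z; rewrite !updE; case: eqP => // ->.
transitivity (mean (fun q : {ffun T -> U} * U => H q.1)).
  by rewrite mean_pair; apply: eq_mean => f; rewrite /= mean_cst.
by rewrite /mean (reindex_inj (inv_inj sigmaK)).
Qed.

Lemma mean_resample_indep a (g : U -> R) G : (0 < #|U|)%N ->
  (forall f c, G (upd f a c) = G f) ->
  mean (fun f => g (f a) * G f) = mean g * mean G.
Proof.
move=> U0 GE; rewrite (mean_resample a)// -meanZl; apply: eq_mean => f.
by rewrite -meanZr; apply: eq_mean => c; rewrite GE updE eqxx.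
Qed.

(** [G] depends only on the values of [f] on [S], and the cells are distinct, so every factor at a
    cell outside [S] is independent of the rest and averages to [mean g]. *)
Lemma mean_prod_split (I : eqType) (cell : I -> T) (g : U -> R)
    (S : pred T) G (bl : seq I) : (0 < #|U|)%N -> injective cell -> uniq bl ->
  (forall f a c, a \notin S -> G (upd f a c) = G f) ->
  mean (fun f => (\prod_(b <- bl) g (f (cell b))) * G f) =
  mean g ^+ count (fun b => cell b \notin S) bl *
  mean (fun f => (\prod_(b <- bl | cell b \in S) g (f (cell b))) * G f).
Proof.
move=> U0 cell_inj.
elim: bl G => [|b bl IH] G /=.
  by move=> _ _; rewrite mul1r; apply: eq_mean => f; rewrite !big_nil.
move=> /andP[bbl blu] GE.
have [bS|bS] := boolP (cell b \in S) => /=.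
  rewrite add0n.
  rewrite (eq_mean (g := fun f => (\prod_(b <- bl) g (f (cell b))) *
      (g (f (cell b)) * G f))) => [|f]; last first.
    by rewrite big_cons mulrCA mulrA.
  rewrite IH//; last first.
    move=> f a c aS; rewrite GE// updE; case: eqP => // ab.
    by rewrite -ab bS in aS.
  congr (_ * _); apply: eq_mean => f.
  by rewrite big_cons bS mulrCA mulrA.
rewrite exprS -mulrA.
rewrite (eq_mean (g := fun f => g (f (cell b)) *
    ((\prod_(b <- bl) g (f (cell b))) * G f))) => [|f]; last first.
  by rewrite big_cons mulrA.
rewrite mean_resample_indep//; last first.
  move=> f c; rewrite GE//; congr (_ * _); rewrite big_seq [RHS]big_seq.
  apply: eq_bigr => b' b'bl; rewrite updE (inj_eq cell_inj).
  by case: eqP => // b'b; rewrite -b'b b'bl in bbl.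
rewrite IH//; congr (_ * (_ * _)); apply: eq_mean => f.
by rewrite big_cons (negbTE bS).
Qed.

End Resampling.

Section Collisions.
Variables (T I P : finType).
Implicit Types (phi : {ffun T * I -> P}) (s : seq T).

Definition hit phi s v b := phi (v, b) \in [seq phi (u, b) | u <- s].

Definition hits phi s v : nat := \sum_(b : I) hit phi s v b.

(** Each element is compared only with the later ones, so the choices of the head of the list are
    independent of the collisions already counted in its tail. *)
Fixpoint collisions phi s : nat :=
  if s is v :: s' then hits phi s' v + collisions phi s' else 0.

Fixpoint collisions_at phi s b : nat :=
  if s is v :: s' then hit phi s' v b + collisions_at phi s' b else 0.

(** A class of [r >= 2] elements sharing a position in block [b] contributes [r] on the left and
    [r - 1] to [collisions_at], and [r <= 2 * (r - 1)]. *)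
Lemma sum_hit_rem phi s b : uniq s ->
  (\sum_(v <- s) hit phi (rem v s) v b <= 2 * collisions_at phi s b)%N.
Proof.
elim: s => [|v s IH] /=; first by rewrite big_nil.
move=> /andP[vs su]; rewrite big_cons eqxx mulnDr mul2n -addnn -addnA leq_add2l.
(* The elements of [s] that become hit only through the arrival of [v]. Two of them would hit each
   other already, so there is at most one, and only if [v] is itself hit. *)
pose lone u := (phi (u, b) == phi (v, b)) && ~~ hit phi (rem u s) u b.
have le1 : (count lone s <= hit phi s v b)%N.
  have [|nohit] := boolP (hit phi s v b); last first.
    rewrite leqn0 -leqn0 leqNgt -has_count; apply: contra nohit.
    by move=> /hasP[u us /andP[/eqP uv _]]; apply/mapP; exists u.
  move=> _; rewrite leqNgt; apply/negP => c2.
  have := c2; rewrite -size_filter.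
  have : uniq [seq u <- s | lone u] by rewrite filter_uniq.
  have : forall u, u \in [seq u <- s | lone u] -> lone u && (u \in s).
    by move=> u; rewrite mem_filter.
  case: [seq u <- s | lone u] => [|u1 [|u2 r]]//= mem /andP[]; rewrite inE negb_or.
  move=> /andP[u12 _] _ _.
  have /andP[/andP[/eqP u1v /negP u1n] _] : lone u1 && (u1 \in s).
    by apply: mem; rewrite inE eqxx.
  have /andP[/andP[/eqP u2v _] u2s] : lone u2 && (u2 \in s).
    by apply: mem; rewrite !inE eqxx orbT.
  apply: u1n; apply/mapP; exists u2; last by rewrite u1v u2v.
  by rewrite mem_rem_uniq// inE eq_sym u12.
apply: (@leq_trans (count lone s + \sum_(u <- s) hit phi (rem u s) u b)%N).
  rewrite -sum1_count [X in (_ <= X + _)%N]big_mkcond -big_split/= big_seq [X in (_ <= X)%N]big_seq.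
  apply: leq_sum => u us.
  have /negbTE -> : v != u by apply: contraNneq vs => ->.
  rewrite /lone {1}/hit map_cons inE -/(hit _ _ _ _).
  by case: (_ == _); case: (hit _ _ _ _).
by apply: leq_add le1 (IH su).
Qed.

Lemma sum_hits_rem phi s : uniq s ->
  (\sum_(v <- s) hits phi (rem v s) v <= 2 * collisions phi s)%N.
Proof.
move=> su; rewrite exchange_big/=.
apply: leq_trans (leq_sum _ (fun b _ => sum_hit_rem phi b su)) _.
rewrite -big_distrr leq_mul2l/=.
elim: {su} s => [|v s IH] /=; first by rewrite big1.
by rewrite big_split leq_add2l.
Qed.

Variable R : realType.

(** Given the choices of [s], those of [v] in different blocks are independent and each hits with
    probability at most [size s / #|P|]. Resampling them one block at a time multiplies the
    generating function by one factor per block. *)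
Lemma mean_exp_hits (z : R) (s : seq T) (v : T) (bl : seq I)
    (H : {ffun T * I -> P} -> R) : 1 <= z -> v \notin s -> uniq bl ->
  (forall phi, 0 <= H phi) ->
  (forall phi b p, H (upd phi (v, b) p) = H phi) ->
  (0 < #|P|)%N ->
  mean (fun phi => z ^+ (\sum_(b <- bl) hit phi s v b) * H phi) <=
  (1 + (z - 1) * (size s)%:R / #|P|%:R) ^+ size bl * mean H.
Proof.
move=> z1 vs + H0 HE P0; elim: bl => [_|b bl IH] /=.
  by rewrite mul1r; apply: le_mean => phi; rewrite big_nil mul1r.
move=> /andP[bbl /IH{}IH].
set t := 1 + _ in IH *.
have t0 : 0 <= t.
  by rewrite /t addr_ge0// mulr_ge0 ?invr_ge0 ?ler0n// mulr_ge0 ?ler0n ?subr_ge0.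
rewrite exprS -mulrA; apply: le_trans (ler_wpM2l t0 IH).
rewrite (mean_resample (v, b))// -meanZl; apply: le_mean => phi.
set rest := z ^+ _ * _.
have rest0 : 0 <= rest by rewrite mulr_ge0// exprn_ge0// (le_trans ler01).
have hitE p b' u : u \in s -> upd phi (v, b) p (u, b') = phi (u, b').
  move=> us; rewrite updE xpair_eqE; case: eqP => // uv.
  by rewrite -uv us in vs.
have mapE p b' : [seq upd phi (v, b) p (u, b') | u <- s] = [seq phi (u, b') | u <- s].
  by apply/eq_in_map => u us; exact: hitE.
rewrite (eq_mean (g := fun p =>
    z ^+ (p \in [seq phi (u, b) | u <- s]) * rest)) => [|p]; last first.
  rewrite HE big_cons exprD -mulrA /rest; congr (_ ^+ _ * (_ ^+ _ * _)).
    by rewrite /hit mapE updE eqxx.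
  rewrite big_seq [RHS]big_seq; apply: eq_bigr => b' b'bl.
  rewrite /hit mapE updE xpair_eqE eqxx /=.
  by case: eqP => // b'b; rewrite -b'b b'bl in bbl.
rewrite meanZr ler_wpM2r//.
rewrite (eq_mean (g := fun p =>
    1 + (z - 1) * (p \in [seq phi (u, b) | u <- s])%:R)) => [|p]; last first.
  by case: (_ \in _); [rewrite expr1 mulr1; ring|rewrite expr0 mulr0 addr0].
rewrite meanD mean_cst// meanZl lerD2l -mulrA ler_wpM2l ?subr_ge0//.
rewrite /mean ler_wpM2r ?invr_ge0 ?ler0n// -natr_sum ler_nat.
rewrite -(size_map (fun u => phi (u, b)) s); apply: leq_trans (card_size _).
by rewrite -sum1_card [X in (_ <= X)%N]big_mkcond leq_sum// => p _; case: ifP.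
Qed.

(** An exponential moment bound, by induction on the list: the collisions inside the tail ignore the
    choices of its head, so they can serve as the weight [H] of [mean_exp_hits]. *)
Lemma mean_exp_collisions (z : R) (s : seq T) (N : nat) :
  1 <= z -> uniq s -> (size s <= N)%N -> (0 < #|P|)%N ->
  mean (fun phi => z ^+ collisions phi s) <=
  (1 + (z - 1) * N%:R / #|P|%:R) ^+ (#|I| * size s).
Proof.
move=> z1 + + P0.
have z10 : 0 <= (z - 1) / #|P|%:R by rewrite divr_ge0 ?ler0n ?subr_ge0.
elim: s => [_ _|v s IH /= /andP[vs su] sN].
  rewrite muln0 expr0 (eq_mean (g := fun=> 1)) ?mean_cst//.
  by rewrite card_ffun expn_gt0 P0.
rewrite (eq_mean (g := fun phi => z ^+ (\sum_(b <- enum I) hit phi s v b) *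
    z ^+ collisions phi s)) => [|phi]; last by rewrite exprD big_enum.
have Hupd phi b p : z ^+ collisions (upd phi (v, b) p) s = z ^+ collisions phi s.
  congr (_ ^+ _).
  elim: s vs {IH su sN} => [//|u s IH]; rewrite inE negb_or => /andP[vu vs] /=.
  rewrite IH//; congr (_ + _)%N; apply: eq_bigr => b' _.
  rewrite /hit updE xpair_eqE (eq_sym u) (negbTE vu)/=; congr (nat_of_bool (_ \in _)).
  apply/eq_in_map => u' us'; rewrite updE xpair_eqE.
  by case: eqP => // u'v; rewrite -u'v us' in vs.
have H0 phi : 0 <= z ^+ collisions phi s by rewrite exprn_ge0// (le_trans ler01).
apply: le_trans (mean_exp_hits z1 vs (enum_uniq _) H0 Hupd P0) _.
rewrite -cardE mulnS exprD ler_pM//.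
- by rewrite exprn_ge0// addr_ge0// mulrAC mulr_ge0 ?ler0n.
- by apply: mean_ge0 => phi; rewrite exprn_ge0// (le_trans ler01).
- rewrite lerXn2r ?nnegrE//.
  + by rewrite addr_ge0// mulrAC mulr_ge0 ?ler0n.
  + by rewrite addr_ge0// mulrAC mulr_ge0 ?ler0n.
  by rewrite lerD2l ![_ * _ / _]mulrAC ler_wpM2l// ler_nat ltnW.
by apply: IH => //; exact: ltnW.
Qed.

End Collisions.

(** * Lifted weights *)

Section Lift.
Variables (R : realType) (T I P C J : finType).
Variables (c : I * P -> C) (beta : J -> bool -> R).
Hypothesis c_inj : injective c.
Hypothesis beta_ge0 : forall j e, 0 <= beta j e.
Hypothesis beta_le2 : forall j e, beta j e <= 2.
Hypothesis mean_beta : forall j, mean (beta j) = 1.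
Implicit Types (phi : {ffun T * I -> P}) (s : seq T) (w : J -> R).
Implicit Types (x : {ffun C -> bool}).

Definition cell phi v b : C := c (b, phi (v, b)).

(** [beta j] is a density relative to a uniform bit, so the product is the density of a product
    measure on the cells that [v] selects; [w] combines these measures with signs. *)
Definition lift_weight phi w x v : R :=
  \sum_j w j * \prod_b beta j (x (cell phi v b)).

Definition occupied phi s : pred C :=
  fun d => has (fun v => [exists b, cell phi v b == d]) s.

Lemma cell_inj phi v : injective (cell phi v).
Proof. by move=> b b' /c_inj[]. Qed.

Lemma occupied_cell phi s v b : (cell phi v b \in occupied phi s) = hit phi s v b.
Proof.
rewrite unfold_in; apply/hasP/mapP => -[u us].
  by move=> /existsP[b' /eqP/c_inj[-> <-]]; exists u.
by move=> uv; exists u => //; apply/existsP; exists b; rewrite /cell uv.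
Qed.

Lemma prod_lift_upd phi w s x d e : d \notin occupied phi s ->
  \prod_(v <- s) lift_weight phi w (upd x d e) v =
  \prod_(v <- s) lift_weight phi w x v.
Proof.
move=> ds; rewrite big_seq [RHS]big_seq; apply: eq_bigr => v vs.
apply: eq_bigr => j _; congr (_ * _); apply: eq_bigr => b _.
rewrite updE; case: eqP => // bd; case/negP: ds; rewrite unfold_in.
by apply/hasP; exists v => //; apply/existsP; exists b; rewrite bd.
Qed.

(** Cells selected by [v] alone are ignored by [G], and their densities integrate to 1. *)
Lemma mean_beta_prod phi j v s (G : {ffun C -> bool} -> R) :
  (forall x d e, d \notin occupied phi s -> G (upd x d e) = G x) ->
  mean (fun x => (\prod_b beta j (x (cell phi v b))) * G x) =
  mean (fun x => (\prod_(b | hit phi s v b) beta j (x (cell phi v b))) * G x).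
Proof.
move=> GE.
rewrite (mean_prod_split (beta j) _ (@cell_inj phi v) _ GE) ?card_bool//;
  last exact: index_enum_uniq.
rewrite mean_beta expr1n mul1r; apply: eq_mean => x; congr (_ * _).
by apply: eq_bigl => b; rewrite occupied_cell.
Qed.

Lemma lift_weight_norm phi w x v :
  `|lift_weight phi w x v| <= lift_weight phi (fun j => `|w j|) x v.
Proof.
apply: le_trans (ler_norm_sum _ _ _) _; apply: ler_sum => j _.
by rewrite normrM [X in _ * X]ger0_norm// prodr_ge0.
Qed.

Lemma lift_weight_ge0 phi w x v : (forall j, 0 <= w j) ->
  0 <= lift_weight phi w x v.
Proof. by move=> w0; apply: sumr_ge0 => j _; rewrite mulr_ge0// prodr_ge0. Qed.

(** When the head [v] is removed, its cells not shared with the tail integrate to 1, and each of its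
    [hits] shared cells costs a factor of at most 2. *)
Lemma mean_prod_lift_le phi w s : (forall j, 0 <= w j) ->
  mean (fun x => \prod_(v <- s) lift_weight phi w x v) <=
  (\sum_j w j) ^+ size s * 2 ^+ collisions phi s.
Proof.
move=> w0; elim: s => [|v s IH] /=.
  rewrite (eq_mean (g := fun=> 1)) ?mean_cst ?mul1r// => [|x].
    by rewrite card_ffun card_bool expn_gt0.
  by rewrite big_nil.
set G := fun x => \prod_(u <- s) lift_weight phi w x u in IH *.
have G0 x : 0 <= G x by apply: prodr_ge0 => u _; exact: lift_weight_ge0.
rewrite (eq_mean (g := fun x =>
    \sum_j w j * ((\prod_b beta j (x (cell phi v b))) * G x))) => [|x]; last first.
  by rewrite big_cons mulr_suml; apply: eq_bigr => j _; rewrite mulrA.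
rewrite mean_sum exprS exprD [leRHS](_ : _ = \sum_j w j * (2 ^+ hits phi s v *
   ((\sum_j w j) ^+ size s * 2 ^+ collisions phi s))); last first.
  by rewrite -mulr_suml; ring.
apply: ler_sum => j _; rewrite meanZl ler_wpM2l//.
rewrite (mean_beta_prod j v (s := s)) => [|x d e]; last exact: prod_lift_upd.
apply: le_trans (ler_wpM2l _ IH); last by rewrite exprn_ge0.
rewrite -meanZl; apply: le_mean => x; rewrite ler_wpM2r//.
have -> : hits phi s v = #|[pred b | hit phi s v b]|.
  by rewrite -sum1_card [RHS]big_mkcond; apply: eq_bigr => b _; rewrite inE; case: hit.
rewrite -prodr_const; apply: ler_prod => b _.
by rewrite beta_ge0 beta_le2.
Qed.

Lemma norm_mean_prod_lift_le phi w s :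
  `|mean (fun x => \prod_(v <- s) lift_weight phi w x v)| <=
  (\sum_j `|w j|) ^+ size s * 2 ^+ collisions phi s.
Proof.
apply: le_trans (ler_norm_mean _) _.
apply: le_trans (mean_prod_lift_le _ _ _) => //.
apply: le_mean => x; rewrite normr_prod; apply: ler_prod => v _.
by rewrite normr_ge0 lift_weight_norm.
Qed.

(** After the unshared cells of [v] are integrated out, its factor involves at most [D] bits. For
    each fixed [x] the sum over [j] is then an instance of the orthogonality assumption. *)
Lemma mean_prod_lift_eq0 phi w s v (D : nat) : v \in s ->
  (forall (A : pred I) (e : I -> bool), (#|A| <= D)%N ->
     \sum_j w j * \prod_(b | A b) beta j (e b) = 0) ->
  (hits phi (rem v s) v <= D)%N ->
  mean (fun x => \prod_(u <- s) lift_weight phi w x u) = 0.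
Proof.
move=> vs w_orth hD.
set G := fun x => \prod_(u <- rem v s) lift_weight phi w x u.
rewrite (eq_mean (g := fun x =>
    \sum_j w j * ((\prod_b beta j (x (cell phi v b))) * G x))) => [|x]; last first.
  rewrite (perm_big _ (perm_to_rem vs)) big_cons /= -/(G x) /lift_weight mulr_suml.
  by apply: eq_bigr => j _; rewrite mulrA.
rewrite mean_sum (eq_bigr (fun j => mean (fun x => w j *
  ((\prod_(b | hit phi (rem v s) v b) beta j (x (cell phi v b))) * G x)))); last first.
  move=> j _; rewrite !meanZl (mean_beta_prod j v (s := rem v s))//.
  by move=> x d e; exact: prod_lift_upd.
rewrite -mean_sum /mean big1 ?mul0r// => x _.
rewrite (eq_bigr (fun j => w j *
  (\prod_(b | hit phi (rem v s) v b) beta j (x (cell phi v b))) * G x)); last first.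
  by move=> j _; rewrite mulrA.
rewrite -mulr_suml (w_orth (hit phi (rem v s) v)) ?mul0r//.
apply: leq_trans hD; rewrite -sum1_card big_mkcond.
by apply: leq_sum => b _; rewrite unfold_in /hit; case: ifP.
Qed.

(** If some element has at most [D] hits the inner mean is 0. Otherwise all [N] elements have more,
    so twice the number of collisions is at least [N * D.+1], an event charged to an exponential
    moment. *)
Lemma mean_norm_mean_prod_lift w s (D N : nat) : uniq s -> size s = N ->
  (0 < #|P|)%N ->
  (forall (A : pred I) (e : I -> bool), (#|A| <= D)%N ->
     \sum_j w j * \prod_(b | A b) beta j (e b) = 0) ->
  mean (fun phi => `|mean (fun x => \prod_(v <- s) lift_weight phi w x v)|) <=
  (\sum_j `|w j|) ^+ N / 2 ^+ (N * D.+1) *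
    (1 + 7 * N%:R / #|P|%:R) ^+ (#|I| * N).
Proof.
move=> su sN P0 w_orth.
(* The moment is taken at [z = 8 = 2 * 4]: with [K] collisions, 2 pays for [2 ^+ K] in the norm
   bound, and [4 ^+ K] dominates [2 ^+ (N * D.+1)]. *)
have -> : 7 = 8 - 1 :> R by lra.
rewrite -{4}sN.
apply: le_trans (ler_wpM2l _ (mean_exp_collisions I _ su _ P0)); last first.
- by rewrite sN.
- by rewrite ler1n.
- by rewrite divr_ge0 ?exprn_ge0// sumr_ge0.
rewrite -meanZl; apply: le_mean => phi.
have [/hasP[v vs hv]|/hasPn nh] := boolP (has (fun v => hits phi (rem v s) v <= D)%N s).
  rewrite (mean_prod_lift_eq0 vs w_orth hv) normr0.
  by rewrite mulr_ge0 ?exprn_ge0// divr_ge0 ?exprn_ge0// sumr_ge0.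
apply: le_trans (norm_mean_prod_lift_le _ _ _) _; rewrite sN -mulrA.
rewrite ler_wpM2l ?exprn_ge0 ?sumr_ge0// ler_pdivlMl ?exprn_gt0//.
rewrite -natrX -natrX -natrM -natrX ler_nat (_ : 8 = 2 ^ 3)%N// -expnM -expnD.
rewrite leq_exp2l//; have := sum_hits_rem phi su.
have : (N * D.+1 <= \sum_(v <- s) hits phi (rem v s) v)%N.
  rewrite -sN -sum1_size big_distrl/= big_seq [X in (_ <= X)%N]big_seq.
  by apply: leq_sum => v /nh; rewrite -ltnNge mul1n.
lia.
Qed.

Lemma norm_prod_lift_trivial phi w s x :
  `|\prod_(v <- s) lift_weight phi w x v| <=
  ((\sum_j `|w j|) * 2 ^+ #|I|) ^+ size s.
Proof.
rewrite normr_prod; elim: s => [|v s IH] /=; first by rewrite big_nil.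
rewrite big_cons exprS.
apply: ler_pM => //; first by rewrite prodr_ge0.
apply: le_trans (lift_weight_norm _ _ _ _) _; rewrite mulr_suml.
apply: ler_sum => j _; rewrite ler_wpM2l// -prodr_const.
by apply: ler_prod => b _; rewrite beta_ge0 beta_le2.
Qed.

End Lift.

(** * A dual weight for the disjunction *)

(** The sum is the coefficient of degree [n] in the Lagrange interpolant [p] of [q] at the [n.+1]
    points [t i]. That interpolant is [q] itself, whose degree is below [n]. *)
Lemma divided_difference_eq0 (F : fieldType) n (t : 'I_n.+1 -> F) (q : {poly F}) :
  injective t -> (size q <= n)%N ->
  \sum_i q.[t i] / \prod_(j | j != i) (t i - t j) = 0.
Proof.
move=> t_inj qn.
pose L (i : 'I_n.+1) := \prod_(j | j != i) ('X - (t j)%:P).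
have LE i : L i = \prod_(j <- enum (predC1 i)) ('X - (t j)%:P) by rewrite big_enum.
have sL i : size (L i) = n.+1.
  by rewrite LE size_prod_XsubC -cardE cardC1 card_ord.
have L_lead i : (L i)`_n = 1.
  have /monicP : L i \is monic by exact: monic_prod_XsubC.
  by rewrite lead_coefE sL.
have L0 i k : (L i).[t k] = if i == k then \prod_(j | j != k) (t k - t j) else 0.
  rewrite horner_prod; case: eqP => [->|/eqP ik].
    by apply: eq_bigr => j _; rewrite !hornerE.
  by rewrite (bigD1 k) 1?eq_sym//= !hornerE subrr mul0r.
pose p := \sum_i (q.[t i] / \prod_(j | j != i) (t i - t j)) *: L i.
have pq : p = q.
  apply/eqP; rewrite -subr_eq0; apply/eqP.
  apply: (@roots_geq_poly_eq0 _ _ [seq t i | i <- enum 'I_n.+1]).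
  - apply/allP => _ /mapP[k _ ->]; rewrite rootE !hornerE horner_sum subr_eq0.
    rewrite (bigD1 k)//= hornerE L0 eqxx divfK; last first.
      by apply/prodf_neq0 => j jk; rewrite subr_eq0 (inj_eq t_inj) eq_sym.
    rewrite big1 ?addr0// => i ik.
    by rewrite hornerE L0 (negbTE ik) mulr0.
  - by rewrite map_inj_uniq ?enum_uniq.
  rewrite size_map size_enum_ord (leq_trans (size_polyD _ _))// size_polyN geq_max.
  rewrite (leq_trans qn)// andbT (leq_trans (size_sum _ _ _))//.
  by apply/bigmax_leqP => i _; rewrite (leq_trans (size_scale_leq _ _))// sL.
rewrite -[RHS](_ : q`_n = 0); last by rewrite nth_default.
rewrite -[in RHS]pq coef_sum; apply: eq_bigr => i _.
by rewrite coefZ L_lead mulr1.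
Qed.

Section OrDual.
Variable R : realType.

(** The nodes are 0, 1, 16, 64, 144 and so on. Quadratic spacing, as for Chebyshev points near an
    endpoint, makes the weights decay like inverse squares; the factor 16 keeps the node 1 apart, so
    that nearly all the positive mass sits there. *)
Definition node (i : nat) : R :=
  if i is j.+1 then (if j is _.+1 then 16 * j%:R ^+ 2 else 1) else 0.

Lemma node_lt i j : (i < j)%N -> node i < node j.
Proof.
case: i j => [|[|i]] [|[|j]] //= ij; rewrite ?ltr01 ?mulr_gt0 ?exprn_gt0 ?ltr0n//.
  rewrite (@lt_le_trans _ _ 16)//; first by rewrite ltr1n.
  by rewrite ler_peMr ?ler0n// exprn_ege1// ler1n.
by rewrite ltr_pM2l ?ltr0n// ltrXn2r ?nnegrE ?ler0n//= ltr_nat; lia.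
Qed.

Lemma node_inj : injective node.
Proof.
move=> i j ij; case: (ltngtP i j) => // /node_lt; by rewrite ij ltxx.
Qed.

Lemma node_gt0 i : (0 < i)%N -> 0 < node i.
Proof. by move=> /node_lt. Qed.

Lemma sum_inv_sqr_le2 D : \sum_(j < D) (j.+1%:R ^+ 2)^-1 <= 2 :> R.
Proof.
case: D => [|D]; first by rewrite big_ord0.
(* The strengthened bound makes the induction go through, as in a telescoping sum. *)
apply: (@le_trans _ _ (2 - D.+1%:R^-1)); last by rewrite gerBl invr_ge0 ler0n.
elim: D => [|D IH]; first by rewrite big_ord1 expr1n invr1; lra.
rewrite big_ord_recr/=; apply: le_trans (lerD IH (lexx _)) _.
rewrite -[D.+2%:R]natr1; set x : R := D.+1%:R.
have x0 : 0 < x by rewrite ltr0n.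
rewrite -subr_ge0.
have -> : 2 - (x + 1)^-1 - (2 - x^-1 + ((x + 1) ^+ 2)^-1) = (x * (x + 1) ^+ 2)^-1.
  by field; rewrite !gt_eqF//; lra.
by rewrite invr_ge0 mulr_ge0 ?sqr_ge0// ltW.
Qed.

Lemma fact_sqr_le D i : (i <= D)%N -> (D`! * D`! <= (D - i)`! * (D + i)`!)%N.
Proof.
elim: i => [|i IH] iD; first by rewrite subn0 addn0.
apply: leq_trans (IH (ltnW iD)) _; rewrite addnS factS.
have -> : (D - i = (D - i.+1).+1)%N by lia.
rewrite factS -mulnA [leqRHS]mulnCA leq_mul2r.
by apply/orP; right; lia.
Qed.

(* Reindexing by [j.+1], this is [prod_(1 <= j <= D, j != i) j^2 / |i^2 - j^2| =
   2 (D!)^2 / ((D - i)! (D + i)!)] with [i = e.+1]. *)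
Lemma prod_sqr_ratio D e : (e < D)%N ->
  (\prod_(j < D | j != e :> nat) (j.+1%:R ^+ 2 / `|e.+1%:R ^+ 2 - j.+1%:R ^+ 2|)) *
    ((D - e.+1)`! * (D + e.+1)`!)%:R = 2 * (D`!%:R) ^+ 2 :> R.
Proof.
elim: D => // D IH; rewrite ltnS leq_eqVlt => /orP[/eqP eD|eD]; last first.
  rewrite big_mkcond big_ord_recr -big_mkcond/= gtn_eqF// -mulrA.
  have -> : `|e.+1%:R ^+ 2 - D.+1%:R ^+ 2| = (D - e)%:R * (D + e).+2%:R :> R.
    rewrite ler0_norm; last by rewrite subr_le0 lerXn2r ?nnegrE ?ler_nat// ltnW.
    have -> : (D + e).+2%:R = D.+1%:R + e.+1%:R :> R by rewrite -natrD; congr _%:R; lia.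
    have -> : (D - e)%:R = D.+1%:R - e.+1%:R :> R by rewrite -natrB ?subSS// ltnW.
    by ring.
  rewrite subSS; have -> : (D - e = (D - e.+1).+1)%N by lia.
  rewrite (_ : D.+1 + e.+1 = (D + e.+1).+1)%N // !factS.
  rewrite [RHS](_ : _ = D.+1%:R ^+ 2 * (2 * D`!%:R ^+ 2)); last by rewrite natrM; ring.
  rewrite -IH// !natrM addnS.
  have : (D - e.+1).+1%:R != 0 :> R by [].
  have : (D + e).+2%:R != 0 :> R by [].
  move: ((D + e).+2%:R : R) ((D - e.+1).+1%:R : R) => a b a0 b0.
  by field; rewrite a0 b0.
subst e.
rewrite big_mkcond big_ord_recr -big_mkcond/= eqxx mulr1 subnn fact0 mul1n.
rewrite (eq_bigl xpredT) => [|j]; last by rewrite ltn_eqF.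
have -> : \prod_(j < D) (j.+1%:R ^+ 2 / `|D.+1%:R ^+ 2 - j.+1%:R ^+ 2|) =
  (\prod_(j < D) j.+1%:R) ^+ 2 / ((\prod_(j < D) (D - j)%:R) *
    (\prod_(j < D) (D.+2 + j)%:R)) :> R.
  rewrite -prodrXl -big_split -prodf_div; apply: eq_bigr => j _ /=.
  rewrite ger0_norm; last first.
    by rewrite subr_ge0 lerXn2r ?nnegrE ?ler0n// ler_nat ltnW// ltnS.
  congr (_ / _).
  have -> : (D.+2 + j)%:R = D.+1%:R + j.+1%:R :> R by rewrite -natrD; congr _%:R; lia.
  have -> : (D - j)%:R = D.+1%:R - j.+1%:R :> R by rewrite -natrB ?subSS// ltnW// ltnS.
  by ring.
have factP n : \prod_(j < n) j.+1%:R = n`!%:R :> R.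
  elim: n => [|n IHn]; first by rewrite big_ord0.
  by rewrite big_ord_recr/= IHn -natrM factS mulnC.
have -> : \prod_(j < D) (D - j)%:R = D`!%:R :> R.
  rewrite -factP (reindex_inj rev_ord_inj)/=; apply: eq_bigr => j _.
  by congr _%:R; have := ltn_ord j; lia.
have rise n : (\prod_(j < n) (D.+2 + j)%:R) * (D.+1)`!%:R = (D.+1 + n)`!%:R :> R.
  elim: n => [|n IHn]; first by rewrite big_ord0 mul1r addn0.
  by rewrite big_ord_recr/= mulrAC IHn -natrM addnS factS mulnC.
rewrite factP.
have -> : \prod_(j < D) (D.+2 + j)%:R = (D.+1 + D)`!%:R / (D.+1)`!%:R :> R.
  by rewrite -rise mulfK// pnatr_eq0 -lt0n fact_gt0.
rewrite addnS factS natrM factS natrM.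
have -> : (D.+1 + D).+1%:R = 2 * D.+1%:R :> R.
  by rewrite -natrM; congr _%:R; lia.
have f0 n : n`!%:R != 0 :> R by rewrite pnatr_eq0 -lt0n fact_gt0.
have := f0 D; have := f0 (D.+1 + D)%N; have : D.+1%:R != 0 :> R by [].
move: (D.+1%:R : R) ((D.+1 + D)`!%:R : R) (D`!%:R : R) => a b d a0 b0 d0.
by field; rewrite a0 b0 d0.
Qed.

Lemma prod_sqr_ratio_le2 D e : (e < D)%N ->
  \prod_(j < D | j != e :> nat) (j.+1%:R ^+ 2 / `|e.+1%:R ^+ 2 - j.+1%:R ^+ 2|)
  <= 2 :> R.
Proof.
move=> eD; have := prod_sqr_ratio eD; set p := \prod_(_ < _ | _) _ => pE.
have f0 : 0 < ((D - e.+1)`! * (D + e.+1)`!)%:R :> R.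
  by rewrite ltr0n muln_gt0 !fact_gt0.
rewrite -(ler_pM2r f0) pE ler_pM2l// expr2 -natrM ler_nat.
exact: fact_sqr_le.
Qed.

Lemma prod_1B_ge n (x : 'I_n -> R) : (forall j, 0 <= x j <= 1) ->
  1 - \sum_j x j <= \prod_j (1 - x j).
Proof.
elim: n x => [|n IH] x x01; first by rewrite !big_ord0 subr0.
rewrite !big_ord_recl; have /andP[x0 x1] := x01 ord0.
have s0 : 0 <= \sum_(j < n) x (lift ord0 j).
  by apply: sumr_ge0 => j _; case/andP: (x01 (lift ord0 j)).
have := IH (fun j => x (lift ord0 j)) (fun j => x01 _).
set s := \sum_(_ < _) _ in s0 *; set q := \prod_(_ < _) _ => sq.
nra.
Qed.

(** Induction from [(1 - p) * (1 + (n + 1) * p) <= 1 + n * p]. *)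
Lemma exp_1B_le (p : R) n : 0 <= p <= 1 -> (1 - p) ^+ n <= (1 + n%:R * p)^-1.
Proof.
move=> /andP[p0 p1].
have np : 0 <= n%:R * p by rewrite mulr_ge0.
rewrite -[leRHS]mul1r ler_pdivlMr; last by lra.
elim: n {np} => [|n IH]; first by rewrite expr0 mul0r addr0 mul1r.
apply: le_trans IH; rewrite exprS -[n.+1%:R]natr1.
rewrite [leLHS](_ : _ = (1 - p) ^+ n * ((1 - p) * (1 + (n%:R + 1) * p))); last by ring.
rewrite ler_wpM2l ?exprn_ge0 ?subr_ge0//.
have : 0 <= n%:R * p ^+ 2 by rewrite mulr_ge0 ?sqr_ge0.
have := sqr_ge0 p; nra.
Qed.

End OrDual.

Section OrWeight.
Variables (R : realType) (D : nat).
Local Notation node := (node R).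

(** Divided-difference coefficients, scaled so that the weight at node 0 is -1, the sign of a false
    disjunction. *)
Definition or_weight (i : 'I_D.+2) : R :=
  - (\prod_(j < D.+2 | j != ord0) (node 0 - node j) /
     \prod_(j < D.+2 | j != i) (node i - node j)).

Lemma or_weight_orth (q : {poly R}) : (size q <= D.+1)%N ->
  \sum_i or_weight i * q.[node i] = 0.
Proof.
move=> /(divided_difference_eq0 (t := fun i : 'I_D.+2 => node i)) q0.
rewrite (eq_bigr (fun i : 'I_D.+2 => - (\prod_(j < D.+2 | j != ord0) (node 0 - node j)) *
  (q.[node i] / \prod_(j | j != i) (node i - node j)))) => [|i _]; last first.
  by rewrite /or_weight; ring.
rewrite -mulr_sumr q0 ?mulr0// => i j /(@node_inj R) ij; exact: val_inj.
Qed.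

Lemma or_weight0 : or_weight ord0 = -1.
Proof.
rewrite /or_weight divff//; apply/prodf_neq0 => j j0.
by rewrite subr_eq0 eq_sym gt_eqF// node_gt0// lt0n.
Qed.

Lemma norm_or_weight i : i != ord0 ->
  `|or_weight i| =
  \prod_(j < D.+2 | (j != ord0) && (j != i)) (node j / `|node i - node j|).
Proof.
move=> i0; rewrite normrN normrM normfV !normr_prod prodf_div.
rewrite (bigD1 i)//= [X in _ / X](bigD1 ord0)/=; last by rewrite eq_sym.
have i_gt0 : 0 < node i by rewrite node_gt0// lt0n.
rewrite sub0r normrN subr0 invfM mulrACA divff ?mul1r; last first.
  by rewrite normr_eq0 gt_eqF.
congr (_ / _); last by apply: eq_bigl => j; rewrite andbC.
apply: eq_bigr => j /andP[j0 _].
by rewrite sub0r normrN ger0_norm// ltW// node_gt0// lt0n.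
Qed.

Lemma node_sub_1 j : 0 < node j.+2 - 1.
Proof. by rewrite subr_gt0; apply: (@node_lt R 1). Qed.

(** The norm is the inverse of the product of the [1 - x j] with [x j = 1 / (16 * j.+1 ^ 2)]; that
    product is at least [1 - 2 / 16] by [prod_1B_ge]. *)
Lemma norm_or_weight1_le : `|or_weight (lift ord0 ord0)| <= 8 / 7.
Proof.
rewrite norm_or_weight// big_mkcond !big_ord_recl/= !mul1r.
pose x (j : 'I_D) := (16 * j.+1%:R ^+ 2)^-1 : R.
have x01 j : 0 <= x j <= 1.
  rewrite invr_ge0 mulr_ge0 ?sqr_ge0//= invf_le1 ?mulr_gt0 ?exprn_gt0 ?ltr0n//.
  by rewrite mulr_ege1 ?exprn_ege1 ?ler1n.
have x_lt1 j : 0 < 1 - x j.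
  rewrite subr_gt0 invf_lt1 ?mulr_gt0 ?exprn_gt0 ?ltr0n//.
  by rewrite (@lt_le_trans _ _ 16) ?ltr1n// ler_peMr ?exprn_ege1 ?ler1n.
rewrite (eq_bigr (fun j => (1 - x j)^-1)) => [|j _]; last first.
  rewrite distrC ger0_norm; last by rewrite ltW// node_sub_1.
  have := x_lt1 j; rewrite /x /=; set y : R := 16 * _ => xj.
  have y0 : 0 < y by rewrite mulr_gt0 ?exprn_gt0 ?ltr0n.
  have y1 : 0 < y - 1 by apply: node_sub_1.
  have -> : 1 - y^-1 = (y - 1) / y by rewrite mulrBl divff ?gt_eqF// mul1r.
  by rewrite invfM invrK mulrC.
rewrite prodfV -[leRHS]invrK lef_pV2 ?posrE//; last 1 first.
- by apply: prodr_gt0 => j _.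
apply: le_trans (prod_1B_ge x01).
have -> : \sum_j x j = 16^-1 * \sum_(j < D) (j.+1%:R ^+ 2)^-1.
  by rewrite mulr_sumr; apply: eq_bigr => j _; rewrite /x invfM.
by rewrite invf_div; have := sum_inv_sqr_le2 R D; lra.
Qed.

(** With [i = e.+1], the node 1 contributes [1 / (16 * i ^ 2 - 1) <= 1 / (15 * i ^ 2)]. In the
    ratios of the remaining nodes the factors 16 cancel, which leaves the product bounded by 2 in
    [prod_sqr_ratio_le2]. *)
Lemma norm_or_weight_tail (e : 'I_D) :
  `|or_weight (lift ord0 (lift ord0 e))| <= 2 / 15 * (e.+1%:R ^+ 2)^-1.
Proof.
rewrite norm_or_weight// big_mkcond !big_ord_recl/= mul1r.
rewrite [X in _ * X](_ : _ = \prod_(j < D | j != e :> nat)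
  (j.+1%:R ^+ 2 / `|e.+1%:R ^+ 2 - j.+1%:R ^+ 2|)); last first.
  rewrite [RHS]big_mkcond; apply: eq_bigr => j _ /=.
  rewrite !(inj_eq lift_inj) -val_eqE; case: ifP => //= _.
  rewrite -mulrBr normrM [`|16|]ger0_norm// invfM mulrACA divff ?mul1r//.
rewrite mul1r [leRHS](_ : _ = (15 * e.+1%:R ^+ 2)^-1 * 2); last by rewrite (invfM 15) [RHS]mulrC mulrA.
apply: ler_pM; rewrite ?prod_sqr_ratio_le2//.
  by apply: prodr_ge0 => j _; rewrite divr_ge0 ?sqr_ge0.
rewrite ger0_norm; last by rewrite ltW// node_sub_1.
rewrite lef_pV2 ?posrE ?mulr_gt0 ?exprn_gt0 ?ltr0n// ?node_sub_1//=.
rewrite -[(0 + bump 0 e)%N]/e.+1.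
have : 1 <= e.+1%:R ^+ 2 :> R by rewrite exprn_ege1 ?ler1n.
by lra.
Qed.

Lemma sum_norm_or_weight_tail :
  \sum_(i < D.+1) `|or_weight (lift ord0 i)| <= 3 / 2.
Proof.
rewrite big_ord_recl.
have := norm_or_weight1_le; have := sum_inv_sqr_le2 R D.
have : \sum_(e < D) `|or_weight (lift ord0 (lift ord0 e))| <=
  2 / 15 * \sum_(e < D) (e.+1%:R ^+ 2)^-1.
  by rewrite mulr_sumr; apply: ler_sum => e _; exact: norm_or_weight_tail.
set a := \sum_(_ < _) _; set b := \sum_(_ < _) _; lra.
Qed.

Lemma sum_norm_or_weight : \sum_i `|or_weight i| <= 5 / 2.
Proof.
rewrite big_ord_recl or_weight0 normrN1.
by have := sum_norm_or_weight_tail; lra.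
Qed.

Hypothesis D_gt0 : (0 < D)%N.

Definition or_bias (i : 'I_D.+2) : R := node i / (16 * D%:R ^+ 2).

Let M_gt0 : 0 < 16 * D%:R ^+ 2 :> R.
Proof. by rewrite mulr_gt0 ?exprn_gt0 ?ltr0n. Qed.

Lemma or_bias01 i : 0 <= or_bias i <= 1.
Proof.
have D1 : 1 <= D%:R ^+ 2 :> R by rewrite exprn_ege1 ?ler1n.
have n0 : 0 <= node i.
  by case: i => -[|i] //= _; rewrite ltW// (node_gt0 R (ltn0Sn i)).
rewrite /or_bias ler_pdivrMr// mul1r divr_ge0 ?(ltW M_gt0)//=.
case: i {n0} => -[|[|i]] /= iD; [by lra|by lra|].
by rewrite ler_pM2l// lerXn2r ?nnegrE// ler_nat.
Qed.

(** The Bernoulli density relative to a uniform bit, whence the factor 2. *)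
Definition or_bit (i : 'I_D.+2) (e : bool) : R :=
  if e then 2 * or_bias i else 2 * (1 - or_bias i).

Lemma or_bit_ge0 i e : 0 <= or_bit i e.
Proof. by have := or_bias01 i; rewrite /or_bit; case: e => /andP[]; lra. Qed.

Lemma or_bit_le2 i e : or_bit i e <= 2.
Proof. by have := or_bias01 i; rewrite /or_bit; case: e => /andP[]; lra. Qed.

Lemma mean_or_bit i : mean (or_bit i) = 1.
Proof. by rewrite /mean card_bool big_bool /or_bit/=; lra. Qed.

(** Each factor is affine in [node i], so the product is a polynomial of degree at most [D] in it,
    which the divided difference annihilates. *)
Lemma or_bit_orth (I : finType) (A : pred I) (e : I -> bool) : (#|A| <= D)%N ->
  \sum_i or_weight i * \prod_(b | A b) or_bit i (e b) = 0.
Proof.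
move=> AD; pose z : R := 2 / (16 * D%:R ^+ 2).
pose q : {poly R} := \prod_(b | A b) (if e b then z *: 'X else 2%:P - z *: 'X).
rewrite -[RHS](or_weight_orth (q := q)).
  apply: eq_bigr => i _; congr (_ * _); rewrite horner_prod; apply: eq_bigr => b _.
  rewrite /or_bit /or_bias /z; move: (16 * _)^-1 => u.
  by case: (e b); rewrite ?hornerD ?hornerN ?hornerZ ?hornerC ?hornerX; ring.
apply: leq_trans (size_poly_prod_leq _ _) _.
rewrite leq_subLR addnS ltnS.
apply: (@leq_trans (\sum_(b | A b) 2)).
  apply: leq_sum => b _.
  have sX : (size (z *: 'X) <= 2)%N by rewrite (leq_trans (size_scale_leq _ _))// size_polyX.
  case: (e b) => //; rewrite (leq_trans (size_polyD _ _))// geq_max size_polyN sX.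
  by rewrite (leq_trans (size_polyC_leq1 _)).
rewrite sum_nat_const; lia.
Qed.

(* With [m] independent bits of bias [or_bias i] the disjunction is false with
   probability [(1 - or_bias i) ^+ m], so this is its correlation. *)
Lemma or_correlation (m : nat) : m = (512 * D ^ 2)%N ->
  19 / 10 <= \sum_i or_weight i * (1 - 2 * (1 - or_bias i) ^+ m).
Proof.
move=> mE.
have w_sum : \sum_i or_weight i = 0.
  rewrite -[RHS](or_weight_orth (q := 1)) ?size_poly1//.
  by apply: eq_bigr => i _; rewrite hornerE mulr1.
rewrite (eq_bigr (fun i => or_weight i - 2 * (or_weight i * (1 - or_bias i) ^+ m)));
  last by move=> i _; ring.
rewrite sumrB w_sum -mulr_sumr big_ord_recl or_weight0.
have -> : or_bias ord0 = 0 by rewrite /or_bias mul0r.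
rewrite subr0 expr1n.
set S := \sum_(_ < _) _.
(* Away from node 0 the bias times [m] is at least [512 / 16 = 32], so the disjunction is false with
   probability at most [1 / 33]; [3 / 2] is the total weight there. The correlation [2 - 2 * S] is
   then at least [2 - 1 / 11]. *)
suff : S <= 33^-1 * (3 / 2) by lra.
apply: (@le_trans _ _ (33^-1 * \sum_(i < D.+1) `|or_weight (lift ord0 i)|)); last first.
  by rewrite ler_pM2l ?invr_gt0// sum_norm_or_weight_tail.
rewrite mulr_sumr; apply: ler_sum => i _; rewrite mulrC.
have p01 := or_bias01 (lift ord0 i); have /andP[p0 p1] := p01.
apply: (@le_trans _ _ ((1 - or_bias (lift ord0 i)) ^+ m * `|or_weight (lift ord0 i)|)).
  by rewrite ler_wpM2l ?ler_norm// exprn_ge0 ?subr_ge0.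
rewrite ler_wpM2r//; apply: le_trans (exp_1B_le _ p01) _.
rewrite lef_pV2 ?posrE//; last by rewrite ltr_pwDl// mulr_ge0.
have : 32 <= m%:R * or_bias (lift ord0 i).
  rewrite /or_bias mulrA ler_pdivlMr// mE natrM natrX.
  have n1 : 1 <= node (lift ord0 i).
    by case: (i) => -[|i'] iD //=; rewrite ltW//; exact: (@node_lt R 1 i'.+2).
  rewrite [leRHS](_ : _ = 32 * (16 * D%:R ^+ 2) * node (lift ord0 i)); last by ring.
  by rewrite ler_peMr// mulr_ge0// ltW.
by lra.
Qed.

End OrWeight.

(** * Protocols *)

Section ProtocolValue.
Variables (R : realType) (k n : nat).
Implicit Types (p : protocol k n) (x : input k n) (b : seq bool).

Definition sgn (e : bool) : R := if e then 1 else -1.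

(** The output as a sign. The bit budget [c] makes the recursion structural, and 0 marks an
    exhausted budget. *)
Fixpoint value p c b x : R :=
  match action p b with
  | inl e => sgn e
  | inr i => if c is c'.+1 then value p c' (rcons b (message p b (see x i))) x
             else 0
  end.

Lemma iter_step_ended p x b e t :
  action p b = inl e -> iter t (step p x) b = b.
Proof. by move=> be; elim: t => //= t ->; rewrite /step be. Qed.

Lemma outputs_ended p x b e : action p b = inl e ->
  forall e', outputs p x b e' <-> e = e'.
Proof.
move=> be e'; split=> [[t]|<-]; last by exists 0%N.
by rewrite (iter_step_ended _ _ be) be => -[].
Qed.

Lemma outputs_step p x b i : action p b = inr i ->
  forall e, outputs p x b e <->
    outputs p x (rcons b (message p b (see x i))) e.
Proof.
move=> bi e; have stepE : step p x b = rcons b (message p b (see x i)).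
  by rewrite /step bi.
split=> -[t te]; last by exists t.+1; rewrite iterSr stepE.
case: t te => [|t]; first by rewrite /= bi.
by rewrite iterSr stepE; exists t.
Qed.

Lemma value_outputs p c b x : writes_at_most p x b c ->
  exists2 e, value p c b x = sgn e & forall e', outputs p x b e' <-> e = e'.
Proof.
elim: c b => [|c IH] b; rewrite /writes_at_most.
  rewrite /= /ended; case bE: (action p b) => [e|//] _.
  by exists e => //; exact: outputs_ended.
case bE: (action p b) => [e|i].
  by move=> _; exists e; [rewrite /= bE|exact: outputs_ended].
have stepE : step p x b = rcons b (message p b (see x i)) by rewrite /step bE.
rewrite iterSr stepE => /IH[e ve oe]; exists e => [|e']; first by rewrite /= bE.
by rewrite (outputs_step x bE).
Qed.

End ProtocolValue.

Section JoinInput.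
Variables (R : realType) (k n : nat).
Local Notation X := {ffun 'I_n -> bool}.
Local Notation Y := (n.-tuple bool).

Definition join_input (x : X) (v : k.-tuple Y) : input k.+1 n :=
  [ffun i => tnth (cons_tuple [tuple x l | l < n] v) i].

Definition others (z : input k.+1 n) : k.-tuple Y :=
  [tuple z (lift ord0 j) | j < k].

Lemma others_join x v : others (join_input x v) = v.
Proof. by apply: eq_from_tnth => j; rewrite tnth_mktuple ffunE tnthS. Qed.

Lemma join_input0 x v : join_input x v ord0 = [tuple x l | l < n].
Proof. by rewrite ffunE tnth0. Qed.

Lemma cyl_see (i : 'I_k.+1) (f : view n i -> R) :
  (forall s, `|f s| <= 1) -> cyl (fun x v => f (see (join_input x v) i)).
Proof.
move=> f1; case: (unliftP ord0 i) => [j|] iE; subst i.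
  apply: (@cyl_indepS _ _ _ _ j) => // x v v' vv'; congr f.
  apply/ffunP => -[l /= li]; rewrite !ffunE /=.
  case: (unliftP ord0 l) li => [l' ->|->] li; last by rewrite !tnth0.
  by rewrite !tnthS; apply: vv'; rewrite (inj_eq lift_inj) in li.
apply: cyl_indep0 => // x x' v; congr f.
apply/ffunP => -[l /= li]; rewrite !ffunE /=.
by case: (unliftP ord0 l) li => [l' ->|->]//; rewrite !tnthS.
Qed.

(** A bit written by player [i] ignores the input of [i], so both its indicator [g] and [1 - g] are
    cylinder intersections. Splitting on the bit replaces [chi] by two cylinder intersections, which
    doubles the bound. *)
Lemma value_correlation (Psi : X -> k.-tuple Y -> R) (eps : R)
    (p : protocol k.+1 n) : 0 <= eps ->
  (forall chi, cyl chi ->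
     `|mean (fun x => mean (fun v => Psi x v * chi x v))| <= eps) ->
  forall c b chi, cyl chi ->
    `|mean (fun x => mean (fun v =>
        Psi x v * (chi x v * value R p c b (join_input x v))))| <= 2 ^+ c * eps.
Proof.
move=> eps0 small.
have const c (u : R) chi : cyl chi -> `|u| <= 1 ->
    `|mean (fun x => mean (fun v => Psi x v * (chi x v * u)))| <= 2 ^+ c * eps.
  move=> chi_cyl u1.
  rewrite (eq_mean (g := fun x => mean (fun v => Psi x v * chi x v) * u)) => [|x].
    rewrite meanZr normrM; apply: (@le_trans _ _ eps).
      by rewrite -[eps]mulr1 ler_pM// small.
    by rewrite ler_peMl// exprn_ege1// ler1n.
  by rewrite -meanZr; apply: eq_mean => v; rewrite mulrA.
have sgn1 e : `|sgn R e| <= 1 by case: e; rewrite /sgn ?normrN normr1.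
elim=> [|c IH] b chi chi_cyl /=; case bE: (action p b) => [e|i].
- by have := const 0%N (sgn R e) _ chi_cyl (sgn1 e).
- by have := const 0%N 0 _ chi_cyl; rewrite normr0; apply.
- exact: const.
pose g (s : view n i) : R := (message p b s)%:R.
have cyl_g : cyl (fun x v => chi x v * g (see (join_input x v) i)).
  by apply: cylM => //; apply: cyl_see => s; rewrite /g; case: (message _ _ _);
    rewrite ?normr0 ?normr1.
have cyl_1g : cyl (fun x v => chi x v * (1 - g (see (join_input x v) i))).
  apply: cylM => //; apply: (@cyl_see _ (fun s => 1 - g s)) => s.
  by rewrite /g; case: (message _ _ _); rewrite ?subrr ?subr0 ?normr0 ?normr1.
have := lerD (IH (rcons b true) _ cyl_g) (IH (rcons b false) _ cyl_1g).
rewrite -mulr2n -mulrnAl -mulr_natl -exprS; apply: le_trans.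
apply: le_trans (ler_normD _ _); rewrite -meanD.
rewrite le_eqVlt; apply/orP; left; apply/eqP; congr `|_|.
apply: eq_mean => x; rewrite -meanD; apply: eq_mean => v; rewrite /g.
by case: (message _ _ _) => /=; ring.
Qed.

End JoinInput.

(** The pointwise bound is integrated over the coins, and the finite sum exchanged with the
    integral. It turns an error bound per input into one on the weighted error over all inputs. *)
Lemma prob_average (R : realType) (d : measure_display) (T : measurableType d)
    (P : probability T R) (Z : finType) (a : Z -> R) (A : Z -> set T) (u q : R) :
  0 <= q -> (forall z, 0 <= a z) -> (forall z, measurable (A z)) ->
  (forall z, (P (A z) <= q%:E)%E) ->
  (forall w, u <= \sum_z a z * \1_(A z) w) ->
  u <= q * \sum_z a z.
Proof.
move=> q0 a0 mA PA ua.
(* Positive [u] allows the monotonicity of integrals of nonnegative functions. *)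
have [u0|u0] := leP u 0.
  by rewrite (le_trans u0)// mulr_ge0// sumr_ge0.
pose f z w := ((a z)%:E * (\1_(A z) w)%:E)%E.
pose g z : T -> \bar R := EFin \o (\1_(A z) : T -> R).
have m1 z : measurable_fun setT (g z).
  by apply/measurable_EFinP; exact: measurable_indic.
have mf z : measurable_fun setT (f z).
  by apply: emeasurable_funM; [exact: measurable_cst|exact: m1].
have f0 z w : setT w -> (0 <= f z w)%E.
  by move=> _; rewrite /f mule_ge0// lee_fin// indicE ler0n.
have le_int : (u%:E <= \int[P]_w (\sum_z f z w))%E.
  have <- : (\int[P]_w (cst u%:E w) = u%:E)%E.
    by rewrite integral_cst// -[X in (_ * X)%E]/(P setT) (@probability_setT _ _ _ P) mule1.
  apply: ge0_le_integral => //.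
  - by move=> w _; rewrite lee_fin ltW.
  - exact: emeasurable_sum.
  move=> w _; rewrite /f (eq_bigr (fun z => (a z * \1_(A z) w)%:E)) => [|z _].
    by rewrite sumEFin lee_fin.
  by rewrite EFinM.
rewrite -lee_fin; apply: le_trans le_int _.
rewrite ge0_integral_sum// mulr_sumr -sumEFin; apply: lee_sum => z _.
have g0 w : setT w -> (0 <= g z w)%E.
  by move=> _; change ((0 : R)%:E <= (\1_(A z) w : R)%:E)%E; rewrite lee_fin indicE ler0n.
rewrite /f (@ge0_integralZl_EFin _ _ _ P setT measurableT (g z) g0 (m1 z) _ (a0 z)).
rewrite integral_indic// setIT mulrC.
rewrite EFinM; apply: lee_wpmul2l; [rewrite lee_fin; exact: a0|exact: PA].
Qed.

(** * The randomized lower bound *)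

(** [(1 + x) ^+ m * (1 - x) ^+ m <= 1], while [(1 - x) ^+ m >= 1 - m * x >= 1 / 2]. *)
Lemma exp_1D_le2 (R : realType) (x : R) m : 0 <= x -> m%:R * x <= 1 / 2 ->
  (1 + x) ^+ m <= 2.
Proof.
move=> x0; case: m => [|m] mx; first by rewrite expr0 ler1n.
have x1 : x <= 1.
  have : x <= m.+1%:R * x by rewrite ler_peMl// ler1n.
  by lra.
have h : 1 / 2 <= (1 - x) ^+ m.+1.
  have := prod_1B_ge (x := fun _ : 'I_m.+1 => x); rewrite x0 x1.
  rewrite sumr_const prodr_const !card_ord -mulr_natl => /(_ (fun=> erefl)).
  by apply: le_trans; lra.
have p1 : (1 + x) ^+ m.+1 * (1 - x) ^+ m.+1 <= 1.
  rewrite -exprMn exprn_ile1//; have := sqr_ge0 x; nra.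
have p0 : 0 <= (1 + x) ^+ m.+1 by rewrite exprn_ge0// addr_ge0.
nra.
Qed.

(** This choice of [B] makes [m * (7 * N / B) = 7 / 16], so each of the [N] outer factors is at most
    2; the loss is paid by passing from [D.+1] to [D]. *)
Lemma collision_factor_le (R : realType) (m N D B : nat) :
  (0 < m)%N -> (0 < N)%N -> B = (16 * N * m)%N ->
  (1 + 7 * N%:R / B%:R) ^+ (m * N) / 2 ^+ (N * D.+1) <= (2 ^+ (N * D))^-1 :> R.
Proof.
move=> m0 N0 ->.
rewrite mulnS exprD invfM mulrA ler_piMl ?invr_ge0 ?exprn_ge0//.
rewrite ler_pdivrMr ?exprn_gt0// mul1r exprM.
rewrite lerXn2r ?nnegrE ?exprn_ge0 ?addr_ge0 ?divr_ge0 ?mulr_ge0//.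
apply: exp_1D_le2; first by rewrite divr_ge0// mulr_ge0.
have m0R : 0 < m%:R :> R by rewrite ltr0n.
have N0R : 0 < N%:R :> R by rewrite ltr0n.
rewrite !natrM; move: m0R N0R; move: (m%:R : R) (N%:R : R) => a b a0 b0.
rewrite [leLHS](_ : _ = 7 / 16); first by lra.
by field; rewrite !gt_eqF.
Qed.

Lemma diagonal_factor_le (R : realType) (k m N D n : nat) :
  N = (2 ^ k)%N -> (N * (1 + m + D) <= n)%N ->
  k%:R / (2 ^ n)%:R * (2 ^+ m) ^+ N <= (2 ^+ (N * D))^-1 :> R.
Proof.
move=> NE Nn.
rewrite -exprM mulrAC ler_pdivrMr ?ltr0n ?expn_gt0// ler_pdivlMl ?exprn_gt0//.
rewrite -!natrX -!natrM ler_nat.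
apply: (@leq_trans (2 ^ (N * D) * (2 ^ N * 2 ^ (m * N)))).
  rewrite leq_mul2l; apply/orP; right; rewrite leq_mul2r; apply/orP; right.
  apply: (@leq_trans N); last by rewrite ltnW// ltn_expl.
  by rewrite NE ltnW// ltn_expl.
by rewrite -!expnD leq_exp2l//; nia.
Qed.

Section HardFunction.
Variables (R : realType) (k n D : nat).
Local Notation X := {ffun 'I_n -> bool}.
Local Notation Y := (n.-tuple bool).
Variables m B : nat.
Hypothesis D_gt0 : (0 < D)%N.
Hypothesis D_le_m : (D <= m)%N.
Hypothesis BE : B = (16 * 2 ^ k * m)%N.
Hypothesis mB_le : (m * B <= n)%N.
Local Notation w := (or_weight R (D := D)).
Local Notation bit := (or_bit R (D := D)).
Local Notation W := (\sum_i `|w i|).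

Let card_cells : (#|{: 'I_m * 'I_B}| <= n)%N.
Proof. by rewrite card_prod !card_ord. Qed.

Definition bit_index (q : 'I_m * 'I_B) : 'I_n := widen_ord card_cells (enum_rank q).

Lemma bit_index_inj : injective bit_index.
Proof. by move=> p q /(congr1 val)/= /val_inj/enum_rank_inj. Qed.

Let m_gt0 : (0 < m)%N.
Proof. exact: leq_trans D_le_m. Qed.

Let B_gt0 : (0 < B)%N.
Proof. by rewrite BE !muln_gt0 expn_gt0. Qed.

Let W_ge0 : 0 <= W.
Proof. exact: sumr_ge0. Qed.

Notation Psi phi := (lift_weight (R := R) (T := k.-tuple Y) bit_index bit phi w).

(* Degenerate pairs have probability [k / 2 ^ n], which absorbs the trivial
   bound [(W 2 ^ m) ^ N] on their contribution since [N (m + D) <= n]. *)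
Lemma exists_small_cubenorm :
  exists phi : {ffun k.-tuple Y * 'I_m -> 'I_B},
    cubenorm (Psi phi) <= (2 * W / 2 ^+ D) ^+ (2 ^ k).
Proof.
set N := (2 ^ k)%N; have N_gt0 : (0 < N)%N by rewrite expn_gt0.
apply: mean_le_exists; first by rewrite card_ffun expn_gt0 card_ord B_gt0.
have cardY : #|{: Y}| = (2 ^ n)%N by rewrite card_tuple card_bool.
rewrite /cubenorm exchange_mean.
pose A : R := W ^+ N / 2 ^+ (N * D).
have A0 : 0 <= A by rewrite divr_ge0 ?exprn_ge0.
pose Z : R := (W * 2 ^+ m) ^+ N.
have Z0 : 0 <= Z by rewrite exprn_ge0// mulr_ge0 ?exprn_ge0.
apply: (@le_trans _ _ (A + k%:R / (2 ^ n)%:R * Z)).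
  pose bound (p : k.-tuple (Y * Y)) : R := A + (~~ offdiagonal p)%:R * Z.
  apply: (@le_trans _ _ (mean bound)).
    apply: le_mean => p; rewrite /bound; have [nd|_] := boolP (offdiagonal p).
      rewrite mul0r addr0.
      have := mean_norm_mean_prod_lift bit_index_inj (or_bit_ge0 R D_gt0)
        (or_bit_le2 R D_gt0) (mean_or_bit R (D := D)) (w := w) (D := D)
        (cube_uniq nd) (size_cube p).
      rewrite !card_ord => /(_ B_gt0 (@or_bit_orth R D D_gt0 'I_m)) => /le_trans; apply.
      rewrite /A -/N -mulrA ler_wpM2l ?exprn_ge0// mulrC.
      exact: collision_factor_le.
    rewrite mul1r; apply: (@le_trans _ _ Z); last by rewrite lerDr.
    rewrite -[leRHS](mean_cst (T := {ffun k.-tuple Y * 'I_m -> 'I_B})); last first.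
      by rewrite card_ffun expn_gt0 card_ord B_gt0.
    apply: le_mean => phi; apply: le_trans (ler_norm_mean _) _.
    rewrite -[leRHS](mean_cst (T := X)); last first.
      by rewrite card_ffun expn_gt0 card_bool.
    apply: le_mean => x.
    have := norm_prod_lift_trivial bit_index (or_bit_ge0 R D_gt0)
      (or_bit_le2 R D_gt0) phi w (cube p) x.
    by rewrite size_cube card_ord.
  rewrite /bound meanD mean_cst ?card_tuple ?expn_gt0 ?card_prod ?muln_gt0 ?cardY ?expn_gt0//.
  rewrite lerD2l meanZr ler_wpM2r// -cardY.
  by apply: mean_diagonal; rewrite cardY expn_gt0.
have kn : k%:R / (2 ^ n)%:R * Z <= A.
  rewrite /Z /A exprMn mulrCA ler_wpM2l ?exprn_ge0//.
  apply: diagonal_factor_le => //; apply: leq_trans mB_le.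
  by rewrite BE -/N; nia.
(* Nondegenerate and degenerate pairs contribute at most [A] each, and [2 * A <= 2 ^+ N * A]
   explains the factor 2 in the bound. *)
rewrite [leRHS](_ : _ = 2 ^+ N * A); last first.
  by rewrite /A !exprMn exprVn -exprM mulnC mulrA.
have : 2 * A <= 2 ^+ N * A.
  by rewrite ler_wpM2r// -{1}[2]expr1 ler_weXn2l ?ler1n.
by lra.
Qed.

Lemma mean_norm_lift phi v : mean (fun x => `|Psi phi x v|) <= 5 / 2.
Proof.
apply: le_trans (sum_norm_or_weight R D).
have := mean_prod_lift_le bit_index_inj (or_bit_ge0 R D_gt0) (or_bit_le2 R D_gt0)
  (mean_or_bit R (D := D)) phi (w := fun i => `|w i|) [:: v] (fun i => normr_ge0 _).
rewrite /= expr1 addn0 (_ : hits _ _ _ = 0%N) ?expr0 ?mulr1; last exact: big1.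
apply: le_trans.
apply: le_mean => x; rewrite big_seq1.
exact: (lift_weight_norm _ (or_bit_ge0 R D_gt0)).
Qed.

Lemma lift_correlation phi v : m = (512 * D ^ 2)%N ->
  19 / 10 <=
  mean (fun x => Psi phi x v * sgn R [exists b, x (cell bit_index phi v b)]).
Proof.
move=> mE; apply: le_trans (or_correlation R D_gt0 mE) _.
(* The density restricted to a zero bit, of mean [1 - or_bias j]; the product over the blocks
   accounts for the false disjunction. *)
pose zeros j (e : bool) : R := bit j e * (~~ e)%:R.
have meanP (g : bool -> R) :
    mean (fun x : X => \prod_b g (x (cell bit_index phi v b))) = mean g ^+ m.
  have := @mean_prod_split R _ bool 'I_m (cell bit_index phi v) g pred0 (fun=> 1)
    (index_enum 'I_m).
  rewrite card_bool => /(_ isT (@cell_inj _ _ _ _ _ bit_index_inj phi v) (index_enum_uniq _)).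
  move=> /(_ (fun _ _ _ _ => erefl)) meanE.
  transitivity (mean (fun x : X => \prod_b g (x (cell bit_index phi v b)) * 1)).
    by apply: eq_mean => x; rewrite mulr1.
  rewrite meanE (eq_count (a2 := predT)) // count_predT -[RHS]mulr1.
  congr (_ ^+ _ * _); first by rewrite -[RHS](card_ord m) -sum1_card -sum1_size; apply: eq_bigl.
  rewrite -[RHS](mean_cst (T := X)) ?card_ffun ?card_bool ?expn_gt0//.
  by apply: eq_mean => x; rewrite big_pred0 ?mulr1.
have sgnE x : sgn R [exists b, x (cell bit_index phi v b)] =
    1 - 2 * \prod_b (~~ x (cell bit_index phi v b))%:R.
  have [/existsP[b xb]|/existsPn xb] := boolP [exists b, x (cell bit_index phi v b)].
    by rewrite (bigD1 b)//= xb mul0r mulr0 subr0.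
  by rewrite big1 => [|b _]; [rewrite /sgn; lra|rewrite xb].
rewrite (eq_mean (g := fun x : X => \sum_j w j *
    (\prod_b bit j (x (cell bit_index phi v b)) -
     2 * \prod_b zeros j (x (cell bit_index phi v b))))) => [|x]; last first.
  rewrite sgnE /lift_weight mulr_suml; apply: eq_bigr => j _.
  by rewrite /zeros big_split/=; ring.
rewrite mean_sum le_eqVlt; apply/orP; left; apply/eqP; apply: eq_bigr => j _.
rewrite meanZl meanB meanZl !meanP mean_or_bit expr1n.
congr (_ * (_ - _ * _ ^+ _)).
by rewrite /mean card_bool big_bool /zeros /or_bit/=; lra.
Qed.

Definition selected_or (phi : {ffun k.-tuple Y * 'I_m -> 'I_B}) (z : input k.+1 n) :=
  [exists b, tnth (z ord0) (cell bit_index phi (others z) b)].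

Lemma selected_or_join phi x v :
  selected_or phi (join_input x v) = [exists b, x (cell bit_index phi v b)].
Proof.
rewrite /selected_or others_join join_input0.
by apply: eq_existsb => b; rewrite tnth_mktuple.
Qed.

(** For each outcome of the coins, the correlation of [Psi phi] with the function exceeds its
    correlation with the protocol by at most twice the weight of the wrong inputs. Averaged over the
    coins, that weight is at most a third of the total. *)
Lemma selected_or_cost phi c (P : randomized_protocol R k.+1 n c) :
  m = (512 * D ^ 2)%N ->
  cubenorm (Psi phi) <= (2 * W / 2 ^+ D) ^+ (2 ^ k) ->
  (forall z, (error P (selected_or phi) z <= (3%:R^-1)%:E)%E) ->
  (D <= c + 5)%N.
Proof.
move=> mE small err.
set eps := 2 * W / 2 ^+ D.
have eps0 : 0 <= eps by rewrite divr_ge0 ?exprn_ge0// mulr_ge0.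
have chi_small chi : cyl chi ->
    `|mean (fun x => mean (fun v => Psi phi x v * chi x v))| <= eps.
  move=> chi_cyl; have := cylinder_correlation (Psi phi) chi_cyl.
  move=> /le_trans/(_ small).
  by rewrite ler_pXn2r ?nnegrE ?expn_gt0.
pose F := selected_or phi.
pose Z : finType := (X * k.-tuple Y)%type.
pose joinZ (z : Z) := join_input z.1 z.2.
pose A (z : Z) := [set w : coins P | ~ outputs (det w) (joinZ z) [::] (F (joinZ z))].
pose a (z : Z) : R := `|Psi phi z.1 z.2| / #|Z|%:R.
have corr : 19 / 10 <= mean (fun z : Z => Psi phi z.1 z.2 * sgn R (F (joinZ z))).
  rewrite mean_pair exchange_mean -[leLHS](mean_cst (T := k.-tuple Y)); last first.
    by rewrite card_tuple expn_gt0 card_tuple expn_gt0 card_bool.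
  apply: le_mean => v; apply: le_trans (lift_correlation phi v mE) _.
  by rewrite le_eqVlt; apply/orP; left; apply/eqP; apply: eq_mean => x;
    rewrite /F /joinZ selected_or_join.
have sum_a : \sum_z a z <= 5 / 2.
  rewrite /a -mulr_suml -/(mean (fun z : Z => `|Psi phi z.1 z.2|)).
  rewrite mean_pair exchange_mean -[leRHS](mean_cst (T := k.-tuple Y)); last first.
    by rewrite card_tuple expn_gt0 card_tuple expn_gt0 card_bool.
  by apply: le_mean => v; exact: mean_norm_lift.
have bound : (19 / 10 - 2 ^+ c * eps) / 2 <= 3^-1 * \sum_z a z.
  apply: (@prob_average R _ _ (law P) Z a A) => [|z|z|z|w0].
  - by rewrite invr_ge0.
  - by rewrite divr_ge0.
  - rewrite (_ : A z = ~` [set w | outputs (det w) (joinZ z) [::] (F (joinZ z))])//.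
    by apply: measurableC; exact: det_measurable.
  - exact: err.
  have := value_correlation (det w0) eps0 chi_small c [::] (cyl1 R _ _ _).
  rewrite -(mean_pair (fun z : Z => Psi phi z.1 z.2 *
    (1 * value R (det w0) c [::] (joinZ z)))) => /(le_trans (ler_norm _)) val_small.
  have : mean (fun z : Z => Psi phi z.1 z.2 * sgn R (F (joinZ z))) -
      mean (fun z : Z => Psi phi z.1 z.2 * (1 * value R (det w0) c [::] (joinZ z)))
    <= mean (fun z : Z => 2 * (`|Psi phi z.1 z.2| * \1_(A z) w0)).
    rewrite -meanB; apply: le_mean => z.
    have [e -> oe] := value_outputs R (det_cost w0 (joinZ z)).
    rewrite indicE; have -> : (w0 \in A z) = (e != F (joinZ z)).
      apply/idP/idP => [/set_mem/= nout|/eqP eF]; last by apply/mem_set => /oe.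
      by apply/eqP => eF; apply: nout; apply/oe.
    have := ler_norm (Psi phi z.1 z.2); have := ler_norm (- Psi phi z.1 z.2).
    rewrite normrN; set r := `|_|; move: (Psi phi _ _) => t.
    by case: e oe (F _) => _ []; rewrite /sgn /=; lra.
  rewrite meanZl [X in _ <= 2 * X](_ : _ = \sum_z a z * \1_(A z) w0); last first.
    by rewrite /mean mulr_suml; apply: eq_bigr => z _; rewrite /a mulrAC.
  by lra.
have W5 := sum_norm_or_weight R D.
have eps5 : eps <= 5 / 2 ^+ D.
  by rewrite ler_wpM2r ?invr_ge0 ?exprn_ge0//; lra.
(* The gap is [19 / 10 - 2 * (1 / 3) * (5 / 2) = 7 / 30]. It gives [2 ^+ D <= (150 / 7) * 2 ^+ c],
   and [150 / 7 <= 2 ^+ 5]. *)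
have : 7 / 30 <= 2 ^+ c * (5 / 2 ^+ D) :> R.
  apply: le_trans (ler_wpM2l _ eps5); last by rewrite exprn_ge0.
  by lra.
rewrite mulrA ler_pdivlMr ?exprn_gt0// => le1.
have : 2 ^+ D <= 2 ^+ (c + 5) :> R.
  rewrite exprD (_ : 2 ^+ 5 = 32); last by rewrite -natrX.
  have : 0 <= 2 ^+ c :> R by rewrite exprn_ge0.
  by lra.
by rewrite -!natrX ler_nat leq_exp2l.
Qed.

End HardFunction.

(** * The nondeterministic upper bound and asymptotics *)

Section NondeterministicProtocol.
Variables k n l : nat.
Local Notation Y := (n.-tuple bool).
Variable S : k.+1.-tuple Y -> pred 'I_n.

(** Completes a view to a full input, with zeros for the unseen piece, so that functions of inputs
    can be evaluated on views. *)
Definition fill (i : 'I_k.+2) (s : view n i) : input k.+2 n :=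
  [ffun j => if insub j is Some j' then s j' else [tuple of nseq n false]].

Lemma fill_see (z : input k.+2 n) (i j : 'I_k.+2) :
  j != i -> fill (see z i) j = z j.
Proof. by move=> ji; rewrite ffunE insubT ffunE. Qed.

Fixpoint decode (b : seq bool) : nat :=
  if b is e :: b' then e + (decode b').*2 else 0.

Lemma decode_surj (i : nat) : (i < 2 ^ l)%N -> exists g : l.-tuple bool, decode g = i.
Proof.
elim: l i => [|l' IH] i; first by rewrite expn0; case: i => // _; exists [tuple].
rewrite expnS => il; have [|g gi] := IH i./2; first by lia.
by exists (cons_tuple (odd i) g); rewrite /= gi odd_double_half.
Qed.

(* The guess is an index [i] written in binary; player [0] checks [i \in S] and
   player [1] checks the bit at [i]. *)
Definition guess_protocol : protocol k.+2 n := Protocol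
  (fun b => if size b == l then inr ord0
            else if size b == l.+1 then inr (lift ord0 ord0)
            else inl (nth false b l && nth false b l.+1))
  (fun b i s => [exists j : 'I_n, (j == decode (take l b) :> nat) &&
     if size b == l then S (others (fill s)) j else tnth (fill s ord0) j]).

Lemma guess_protocol_computes (F : input k.+2 n -> bool) : (n <= 2 ^ l)%N ->
  (forall z, F z = [exists j, S (others z) j && tnth (z ord0) j]) ->
  nondet_computes guess_protocol F l (l + 2).
Proof.
move=> nl FE.
pose e1 (g : l.-tuple bool) z := [exists j : 'I_n, (j == decode g :> nat) && S (others z) j].
pose e2 (g : l.-tuple bool) (z : input k.+2 n) :=
  [exists j : 'I_n, (j == decode g :> nat) && tnth (z ord0) j].
have act0 (g : l.-tuple bool) : action guess_protocol g = inr ord0.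
  by rewrite /= size_tuple eqxx.
have act1 (g : l.-tuple bool) e : action guess_protocol (rcons g e) = inr (lift ord0 ord0).
  by rewrite /= size_rcons size_tuple eqxx gtn_eqF.
have act2 (g : l.-tuple bool) e e' :
    action guess_protocol (rcons (rcons g e) e') = inl (e && e').
  rewrite /= !size_rcons size_tuple gtn_eqF ?ltnS ?leqnSn// gtn_eqF//.
  by rewrite !nth_rcons !size_rcons size_tuple !ltnn ltnSn !eqxx.
have msg0 (g : l.-tuple bool) z : message guess_protocol g (see z ord0) = e1 g z.
  rewrite /= size_tuple eqxx take_oversize ?size_tuple//.
  apply: eq_existsb => j; congr (_ && S _ _).
  by apply: eq_from_tnth => i; rewrite !tnth_mktuple fill_see // eq_sym neq_lift.
have msg1 (g : l.-tuple bool) e z :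
    message guess_protocol (rcons g e) (see z (lift ord0 ord0)) = e2 g z.
  rewrite /= size_rcons size_tuple gtn_eqF// -cats1 take_size_cat ?size_tuple//.
  by apply: eq_existsb => j; rewrite fill_see.
split=> [|z].
  exists 2%N => // g z; rewrite /writes_at_most /= /step act0 msg0 act1 msg1.
  by rewrite /ended act2.
have outE (g : l.-tuple bool) : outputs guess_protocol z g true <-> e1 g z && e2 g z.
  rewrite (outputs_step z (act0 g)) msg0 (outputs_step z (act1 g _)) msg1.
  by rewrite (outputs_ended z (act2 _ _ _)).
rewrite FE; split.
  move=> /existsP[j /andP[jS jz]].
  have [g gj] := decode_surj (leq_trans (ltn_ord j) nl).
  exists g; apply/outE/andP; split; apply/existsP; exists j; by rewrite gj eqxx.
move=> [g /outE/andP[/existsP[i /andP[/eqP ig iS]] /existsP[j /andP[/eqP jg jz]]]].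
apply/existsP; exists j; rewrite jz andbT.
by have -> : j = i by apply: val_inj; rewrite /= ig.
Qed.

Lemma guess_N_complexity (R : realType) (F : input k.+2 n -> bool) : (n <= 2 ^ l)%N ->
  (forall z, F z = [exists j, S (others z) j && tnth (z ord0) j]) ->
  (N_complexity R F <= (l + 2)%N%:R%:E)%E.
Proof.
move=> nl FE; apply: ereal_inf_lbound; exists (l + 2)%N => //.
by exists guess_protocol, l; exact: guess_protocol_computes.
Qed.

End NondeterministicProtocol.

(** The length [m * B] used in the string of player 0, with [m = 512 * D ^ 2] blocks; the exponent
    [k.-1] counts the players that select. *)
Definition degree_bound (k D : nat) : nat :=
  (512 * D ^ 2) * (16 * 2 ^ k.-1 * (512 * D ^ 2)).

Lemma hard_function (R : realType) (k n : nat) : (2 <= k)%N ->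
  exists F : input k n -> bool,
    (forall l, (n <= 2 ^ l)%N -> (N_complexity R F <= (l + 2)%N%:R%:E)%E) /\
    exists2 D, (n < degree_bound k D.+1)%N &
      ((D%:R - 5)%:E <= R_complexity R F)%E.
Proof.
case: k => [|[|k]] // _.
(* [D] is the largest parameter whose construction fits into [n] bits; maximality gives the upper
   bound on [n]. *)
have exD : exists D, (degree_bound k.+2 D <= n)%N.
  by exists 0%N; rewrite /degree_bound exp0n// muln0 mul0n.
have leD D : (degree_bound k.+2 D <= n)%N -> (D <= n)%N.
  apply: leq_trans; rewrite /degree_bound.
  apply: (@leq_trans (512 * D ^ 2)).
    by case: D => // D; rewrite expnS expn1; nia.
  have [->|D0] := posnP D; first by [].
  by rewrite leq_pmulr// !muln_gt0 !expn_gt0 D0.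
have [D Dn maxD] := ex_maxnP exD leD.
have ltD : (n < degree_bound k.+2 D.+1)%N.
  by rewrite ltnNge; apply/negP => /maxD; rewrite ltnn.
(* For [D = 0] the constant false function will do, since [D - 5] is negative. *)
have [D0|D0] := posnP D.
  exists (fun=> false); split=> [l nl|].
    apply: (@guess_N_complexity _ _ _ (fun _ _ => false)) => // z.
    by apply/esym/existsP => -[].
  exists D => //; apply: le_ereal_inf_tmp => _ [c _ <-].
  by rewrite lee_fin D0; have : 0 <= c%:R :> R by []; lra.
pose m := (512 * D ^ 2)%N.
have Dm : (D <= m)%N by rewrite /m expnS expn1; nia.
have [phi small] := exists_small_cubenorm R D0 Dm erefl Dn.
exists (selected_or Dn phi); split=> [l nl|].
  apply: (@guess_N_complexity _ _ _ (fun v j =>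
    [exists b, cell (bit_index Dn) phi v b == j])) => // z.
  apply/existsP/existsP => [[b zb]|[j /andP[/existsP[b /eqP <-] zb]]]; last by exists b.
  by exists (cell (bit_index Dn) phi (others z) b); rewrite zb andbT; apply/existsP; exists b.
exists D => //; apply: le_ereal_inf_tmp => _ [c [P err] <-].
have := selected_or_cost D0 erefl small err.
by rewrite lee_fin lerBlDr -(ler_nat R) natrD.
Qed.

Lemma exp_beats_power (R : realType) (C y : R) (a : nat) : 0 <= C -> 0 < y ->
  exists L0, forall L, L0 <= L -> C * (L ^+ a + 6) ^+ 4 <= expR (y * L).
Proof.
move=> C0 y0; pose j := (4 * a).+1; pose z := y / j%:R.
have z0 : 0 < z by rewrite divr_gt0.
(* For [L >= 1] the left side is at most [C * 7 ^+ 4 * L ^+ (4 * a)]. Since [expR (z * L) >= z * L],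
   the right side is at least [(z * L) ^+ j], where [j] has one power of [L] to spare. *)
exists (Num.max 1 (C * 7 ^+ 4 / z ^+ j)) => L; rewrite ge_max => /andP[L1].
rewrite ler_pdivrMr ?exprn_gt0// => CL.
have L0 : 0 < L by apply: lt_le_trans L1.
have La : 1 <= L ^+ a by exact: exprn_ege1.
apply: (@le_trans _ _ (C * (7 * L ^+ a) ^+ 4)).
  by rewrite ler_wpM2l// lerXn2r ?nnegrE; lra.
apply: (@le_trans _ _ ((z * L) ^+ j)).
  have -> : (z * L) ^+ j = L * z ^+ j * L ^+ (4 * a).
    by rewrite exprMn -[in L ^+ j]/(4 * a).+1 (exprS L) mulrCA mulrA.
  rewrite exprMn -exprM mulrA [(a * 4)%N]mulnC.
  by rewrite ler_wpM2r ?exprn_ge0 ?(ltW L0).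
have -> : expR (y * L) = expR (z * L) ^+ j.
  rewrite -expRM_natl; congr expR; rewrite /z; field.
  by rewrite pnatr_eq0.
rewrite lerXn2r ?nnegrE ?expR_ge0 ?mulr_ge0 ?(ltW L0) ?(ltW z0)//.
  exact: ltW.
by apply: le_trans (expR_ge1Dx _); rewrite lerDr.
Qed.

Lemma log2_expR (R : realType) (x : R) : 0 < x -> expR (log2 x * ln 2) = x.
Proof.
by move=> x0; rewrite /log2 divfK ?lnK ?posrE// gt_eqF// ln_gt0// ltr1n.
Qed.

Lemma near_log2_ge (R : realType) (C : R) :
  \forall n \near \oo, C <= log2 (n%:R : R).
Proof.
have ln2 : 0 < ln 2 :> R by rewrite ln_gt0// ltr1n.
apply: filterS (nbhs_infty_ger (expR (C * ln 2))) => n Cn.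
rewrite /log2 ler_pdivlMr// -ler_expR lnK// posrE.
exact: lt_le_trans (expR_gt0 _) Cn.
Qed.

Lemma le_R_complexity_R1 (R : realType) k n (F : input k n -> bool) :
  (R_complexity R F <= R1_complexity R F)%E.
Proof.
apply: ereal_inf_le_tmp; apply: image_subset => c [P PF]; exists P => z.
have [F0 F1] := PF z; case Fz: (F z); first exact: F1.
by rewrite F0// lee_fin invr_ge0.
Qed.

Lemma natr_degree_bound (R : realType) : exists2 C : R, 0 <= C &
  forall k D, (degree_bound k D)%:R = C * 2 ^+ k.-1 * D%:R ^+ 4.
Proof.
exists (512 * 512 * 16) => [|k D].
  by apply: mulr_ge0; [apply: mulr_ge0|]; exact: ler0n.
by rewrite /degree_bound !natrM !natrX; ring.
Qed.

Lemma trunc_log2_le (R : realType) n : (0 < n)%N ->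
  (trunc_log 2 n)%:R <= log2 (n%:R : R).
Proof.
move=> n0; have ln2 : 0 < ln 2 :> R by rewrite ln_gt0// ltr1n.
rewrite /log2 ler_pdivlMr// -ler_expR expRM_natl !lnK ?posrE ?ltr0n//.
by rewrite -natrX ler_nat trunc_logP.
Qed.

Theorem theorem1p1 (R : realType) (delta : R) (k : nat -> nat)
    (delta_lt1 : delta < 1)
    (k_ge2 : \forall n \near \oo, (2 <= k n)%N)
    (k_le : \forall n \near \oo, (k n)%:R <= delta * log2 (n%:R : R)) :
  [/\ ~ (NPcc R k `<=` BPPcc R k),
      exists F : function_family k,
        polylog (fun n => N_complexity R (F n)) /\
        ~ polylog (fun n => R_complexity R (F n)) &
      NPcc R k <> RPcc R k].
Proof.
suff [F [FN FR]] : exists F : function_family k,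
    polylog (fun n => N_complexity R (F n)) /\
    ~ polylog (fun n => R_complexity R (F n)).
  split; [by move=> /(_ F FN)|by exists F|].
  move=> NP_RP; have : RPcc R k F by rewrite -NP_RP.
  move=> [a Fa]; apply: FR; exists a; apply: filterS Fa => n.
  exact/le_trans/le_R_complexity_R1.
(* At least two players are present only for large [n]; elsewhere the family takes a constant
   default. *)
have hard n : exists F : input (k n) n -> bool, (2 <= k n)%N ->
    (forall l, (n <= 2 ^ l)%N -> (N_complexity R F <= (l + 2)%N%:R%:E)%E) /\
    exists2 D, (n < degree_bound (k n) D.+1)%N &
      ((D%:R - 5)%:E <= R_complexity R F)%E.
  have [k2|k2] := leqP 2 (k n); last by exists (fun=> false).
  by have [F HF] := hard_function R n k2; exists F.
pose F n := sval (cid (hard n)); have FP n := svalP (cid (hard n)).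
exists F; split.
  (* The cost is at most [L + 3] with [L = log2 n], and [L + 3 <= L ^+ 2] once [L >= 3]. *)
  exists 2%N; near=> n.
  have n0 : (0 < n)%N by near: n; exact: nbhs_infty_gt.
  have k2 : (2 <= k n)%N by near: n.
  have L3 : 3 <= log2 (n%:R : R) by near: n; exact: near_log2_ge.
  have [FN _] := FP n k2.
  apply: le_trans (FN (trunc_log 2 n).+1 _) _.
    by rewrite ltnW// trunc_log_ltn.
  rewrite lee_fin addSn -addnS natrD.
  have := trunc_log2_le R n0; nra.
(* A bound [L ^+ a] on the randomized cost forces [D + 1 <= L ^+ a + 6]. Then
   [n < C * 2 ^ (k - 1) * (D + 1) ^ 4] is at most [n ^ delta] times a polylogarithm, which is
   eventually at most [n ^ delta * n ^ (1 - delta) = n], a contradiction. *)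
move=> [a Ra].
have ln2 : 0 < ln 2 :> R by rewrite ln_gt0// ltr1n.
have [C C0 CE] := natr_degree_bound R.
have y0 : 0 < (1 - delta) * ln 2 by rewrite mulr_gt0 ?subr_gt0.
have [L0 HL0] := exp_beats_power a C0 y0.
suff : \forall n \near \oo, False by move=> [N _ /(_ N (leqnn N))].
near=> n.
have n0 : (0 < n)%N by near: n; exact: nbhs_infty_gt.
have k2 : (2 <= k n)%N by near: n.
have kL : (k n)%:R <= delta * log2 (n%:R : R) by near: n.
have LL0 : L0 <= log2 (n%:R : R) by near: n; exact: near_log2_ge.
have L1 : 1 <= log2 (n%:R : R) by near: n; exact: near_log2_ge.
have RL : (R_complexity R (F n) <= (log2 (n%:R : R) ^+ a)%:E)%E by near: n.
have [_ [D nD DR]] := FP n k2.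
have := le_trans DR RL; rewrite lee_fin => DL.
have nE := @log2_expR R n%:R; rewrite ltr0n in nE; have {}nE := nE n0.
have big := HL0 _ LL0.
move: nD; rewrite -(ltr_nat R) CE -nE.
move: L1 kL DL big; set L := log2 _ => L1 kL DL big nD.
have pow2 : 2 ^+ (k n).-1 <= expR (delta * L * ln 2).
  apply: (@le_trans _ _ (2 ^+ k n)); first by rewrite ler_weXn2l ?ler1n ?leq_pred.
  have -> : 2 ^+ k n = expR ((k n)%:R * ln 2) :> R by rewrite expRM_natl lnK ?posrE.
  by rewrite ler_expR ler_wpM2r// ltW.
have Dle : D.+1%:R ^+ 4 <= (L ^+ a + 6) ^+ 4.
  have D6 : D.+1%:R <= L ^+ a + 6 by rewrite -natr1; lra.
  by rewrite lerXn2r ?nnegrE// (le_trans _ D6).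
have : expR (L * ln 2) < expR (L * ln 2); last by rewrite ltxx.
apply: lt_le_trans nD _.
have -> : expR (L * ln 2) = expR (delta * L * ln 2) * expR ((1 - delta) * ln 2 * L).
  by rewrite -expRD; congr expR; ring.
apply: (@le_trans _ _ (expR (delta * L * ln 2) *
    (C * (L ^+ a + 6) ^+ 4))); last by rewrite ler_wpM2l ?expR_ge0.
rewrite [leRHS]mulrCA -[leLHS]mulrA ler_wpM2l//.
by apply: ler_pM; rewrite ?exprn_ge0.
Unshelve. all: by end_near.
Qed.
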